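(* Let $\hat\Omega=\mathbb{R}\times(0,1)$ and $Q>0$. Let $\mathbf{u}=(u_1,u_2)\in C^2(\hat\Omega)\cap C^{0,1}(\overline{\hat\Omega})$ be a solution of the steady incompressible Euler system $(\mathbf{u}\cdot\nabla)\mathbf{u}+\nabla p=0$, $\operatorname{div}\mathbf{u}=0$ in $\hat\Omega$ (for some pressure $p$) with the slip condition $\mathbf{u}\cdot\mathbf{n}=0$ on $\partial\hat\Omega$. If $u_1>0$ in $\hat\Omega$ and $u_1(x_1,x_2)\to 6Qx_2(1-x_2)$ as $x_1\to-\infty$ uniformly for $x_2\in[0,1]$, then $$\mathbf{u}(x_1,x_2)=(6Qx_2(1-x_2),\,0)\quad\text{in }\hat\Omega.$$
   Context: $\mathbf{n}$ is the unit normal to $\partial\hat\Omega$. $C^{0,1}(\overline{\hat\Omega})$ denotes the bounded, globally Lipschitz functions on $\overline{\hat\Omega}$. *)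

(* Defs.v *)
From Stdlib Require Import Reals.
From Coquelicot Require Import Coquelicot.
Open Scope R_scope.

(* Functions on the strip R x (0,1) or its closure are represented by total
   curried functions R -> R -> R; values outside the closed strip are
   irrelevant.  Partial derivatives are only ever taken in the open strip. *)

Definition strip (x1 x2 : R) : Prop := 0 < x2 < 1.
Definition closed_strip (x1 x2 : R) : Prop := 0 <= x2 <= 1.
Definition strip_boundary (x1 x2 : R) : Prop := x2 = 0 \/ x2 = 1.

Definition d1 (f : R -> R -> R) (x1 x2 : R) : R := Derive (fun t => f t x2) x1.
Definition d2 (f : R -> R -> R) (x1 x2 : R) : R := Derive (fun t => f x1 t) x2.

(* [ex_diff_n f k x1 x2] says that all iterated partial derivatives of f of
   order at most k exist and are jointly continuous at (x1, x2). *)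
Definition C_on (k : nat) (D : R -> R -> Prop) (f : R -> R -> R) : Prop :=
  forall x1 x2, D x1 x2 -> ex_diff_n f k x1 x2.

Definition bounded_on (D : R -> R -> Prop) (f : R -> R -> R) : Prop :=
  exists M, forall x1 x2, D x1 x2 -> Rabs (f x1 x2) <= M.

Definition lipschitz_on (D : R -> R -> Prop) (f : R -> R -> R) : Prop :=
  exists L, forall x1 x2 y1 y2, D x1 x2 -> D y1 y2 ->
    Rabs (f x1 x2 - f y1 y2) <= L * dist_euc x1 x2 y1 y2.

Definition C01_on (D : R -> R -> Prop) (f : R -> R -> R) : Prop :=
  bounded_on D f /\ lipschitz_on D f.

(* The momentum equation makes grad p continuous when u is C^1, so no
   regularity of p is required beyond the existence of grad p. *)
Definition euler_with_pressure (D : R -> R -> Prop)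
    (u1 u2 p : R -> R -> R) : Prop :=
  forall x1 x2, D x1 x2 ->
    ex_derive (fun t => p t x2) x1 /\
    ex_derive (fun t => p x1 t) x2 /\
    u1 x1 x2 * d1 u1 x1 x2 + u2 x1 x2 * d2 u1 x1 x2 + d1 p x1 x2 = 0 /\
    u1 x1 x2 * d1 u2 x1 x2 + u2 x1 x2 * d2 u2 x1 x2 + d2 p x1 x2 = 0 /\
    d1 u1 x1 x2 + d2 u2 x1 x2 = 0.

Definition steady_euler (D : R -> R -> Prop) (u1 u2 : R -> R -> R) : Prop :=
  exists p : R -> R -> R, euler_with_pressure D u1 u2 p.

(* Outward unit normal of the strip: (0,-1) on x2 = 0 and (0,1) on x2 = 1;
   meaningful on [strip_boundary] only. *)
Definition normal1 (x1 x2 : R) : R := 0.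
Definition normal2 (x1 x2 : R) : R := 2 * x2 - 1.

Definition slip (u1 u2 : R -> R -> R) : Prop :=
  forall x1 x2, strip_boundary x1 x2 ->
    u1 x1 x2 * normal1 x1 x2 + u2 x1 x2 * normal2 x1 x2 = 0.

Definition poiseuille (Q x2 : R) : R := 6 * Q * x2 * (1 - x2).

(* f(x1, .) -> g as x1 -> -oo, uniformly on [0,1]. *)
Definition unif_lim_minfty (f : R -> R -> R) (g : R -> R) : Prop :=
  forall eps : posreal,
    Rbar_locally m_infty
      (fun x1 => forall x2, 0 <= x2 <= 1 -> Rabs (f x1 x2 - g x2) < eps).

(* Main.v *)
(* Let [U y = 6 Q y (1 - y)], let [psi] be the stream function and let [Y] be the
   height at which the Poiseuille flow has the stream value [psi].

   As [x1 -> -oo], [psi] converges to its Poiseuille counterpart.  Since the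
   derivatives involved are Lipschitz, [u2] and the oscillation of [p] over the
   cross section tend to [0].  Following the streamlines, which are graphs over
   the whole [x1]-axis because [u1 > 0], the Bernoulli law then gives
   [p + |u|^2 / 2 = U(Y)^2 / 2 + c(x1)].

   In the variables [(x1, psi)] the problem is the Euler-Lagrange equation of a
   convex functional, and monotonicity of the operator reads, for
   [J(x1) = int_0^1 u1 u2 (x2 - Y) dx2],
     [J' = int_0^1 u2^2 / 2 (1 + u1 / U(Y)) + (U(Y) - u1)^2 (U(Y) + u1) / (2 U(Y)) dx2].
   So [J] is bounded and [J' >= c J^2], which forces [J = 0], hence [u2 = 0].
   As the equations hold in the open strip only, [J] is truncated to [(e, 1 - e)],
   which costs an error tending to [0] with [e], uniformly in [x1]. *)
Require Import Defs.
From Stdlib Require Import Reals Lra Classical.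
From Coquelicot Require Import Coquelicot.
Open Scope R_scope.

(** * One-variable calculus and growth estimates *)

Lemma is_derive_continuity_pt (f : R -> R) (x l : R) :
  is_derive f x l -> continuity_pt f x.
Proof.
  intros H. apply derivable_continuous_pt. exists l. now apply is_derive_Reals.
Qed.

Lemma is_derive_const_R (c x : R) : is_derive (fun _ : R => c) x 0.
Proof. exact (is_derive_const (K := R_AbsRing) (V := R_NormedModule) c x). Qed.

Lemma is_derive_Rmult (f g : R -> R) (x df dg : R) :
  is_derive f x df -> is_derive g x dg ->
  is_derive (fun t => f t * g t) x (df * g x + f x * dg).
Proof. intros Hf Hg. exact (is_derive_mult f g x df dg Hf Hg Rmult_comm). Qed.

Lemma is_derive_le_lipschitz (f : R -> R) (x l L : R) :
  is_derive f x l -> (forall t, Rabs (f t - f x) <= L * Rabs (t - x)) -> Rabs l <= L.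
Proof.
  intros Hf HL. apply le_epsilon. intros eps Heps.
  destruct (proj1 (is_derive_Reals f x l) Hf eps Heps) as [d Hd].
  assert (Hd0 := cond_pos d). set (h := d / 2).
  assert (Hh : 0 < h < d) by (unfold h; lra).
  specialize (Hd h ltac:(lra)). rewrite (Rabs_pos_eq h) in Hd by lra.
  specialize (Hd ltac:(lra)). specialize (HL (x + h)).
  replace (x + h - x) with h in HL by ring. rewrite (Rabs_pos_eq h) in HL by lra.
  assert (H1 : Rabs ((f (x + h) - f x) / h) <= L).
  { unfold Rdiv. rewrite Rabs_mult, (Rabs_pos_eq (/ h))
      by (left; apply Rinv_0_lt_compat; lra).
    apply Rmult_le_reg_r with h; [lra|]. rewrite Rmult_assoc, Rinv_l; lra. }
  set (q := (f (x + h) - f x) / h) in *.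
  revert H1 Hd. unfold Rabs. repeat destruct Rcase_abs; lra.
Qed.

(** Interpolation: by the mean value theorem the increment of [f] over length [d] is [d f'(c)], and
    [f'(c)] differs from [f' x] by at most [C d]. It turns smallness of a function into smallness of
    its derivative, first for the stream function and then for the momentum flux. *)
Lemma derive_small_of_small (f f' : R -> R) (x d e C : R) :
  0 < d ->
  (forall t, x <= t <= x + d -> is_derive f t (f' t)) ->
  (forall t, x <= t <= x + d -> Rabs (f' t - f' x) <= C * d) ->
  Rabs (f x) <= e -> Rabs (f (x + d)) <= e ->
  d * Rabs (f' x) <= 2 * e + C * d * d.
Proof.
  intros Hd Hf HC H1 H2.
  destruct (MVT_gen f x (x + d) f') as [c [Hc Heq]].
  - intros t Ht. apply Hf. rewrite Rmin_left, Rmax_right in Ht by lra. lra.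
  - intros t Ht. rewrite Rmin_left, Rmax_right in Ht by lra.
    apply (is_derive_continuity_pt f t (f' t)), Hf; lra.
  - rewrite Rmin_left, Rmax_right in Hc by lra.
    specialize (HC c Hc).
    replace (x + d - x) with d in Heq by ring.
    assert (H3 : d * Rabs (f' x) = Rabs (f (x + d) - f x - d * (f' c - f' x))).
    { rewrite Heq. replace (f' c * d - d * (f' c - f' x)) with (d * f' x) by ring.
      rewrite Rabs_mult, (Rabs_pos_eq d); lra. }
    rewrite H3.
    assert (H4 : Rabs (d * (f' c - f' x)) <= d * (C * d)).
    { rewrite Rabs_mult, (Rabs_pos_eq d) by lra. apply Rmult_le_compat_l; lra. }
    revert H1 H2 H4. unfold Rabs. repeat destruct Rcase_abs; intros; nra.
Qed.

(* Past a point where [J >= c], the maximum of [J] on any compact interval sits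
   at its right end, so [J] keeps growing at rate [k]. *)
Lemma bounded_growth (J J' : R -> R) (B c k : R) :
  (forall x, is_derive J x (J' x)) -> (forall x, J x <= B) -> 0 < k ->
  (forall x, c <= J x -> k <= J' x) -> forall x, J x < c.
Proof.
  intros HJ HB Hk Hg x0.
  apply Rnot_le_lt. intros Hc.
  assert (Hmon : forall x, x0 <= x -> J x0 <= J x).
  { intros x Hx.
    destruct (continuity_ab_maj J x0 x Hx) as [m [Hm Hmx]].
    { intros t _. apply (is_derive_continuity_pt J t (J' t)), HJ. }
    assert (Hmc := Hm x0 (conj (Rle_refl _) Hx)).
    destruct (Rle_lt_dec x m) as [Hxm|Hxm].
    { replace x with m by lra. exact Hmc. }
    exfalso.
    assert (HJm := Hg m (Rle_trans _ _ _ Hc Hmc)).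
    destruct (proj1 (is_derive_Reals J m (J' m)) (HJ m) (k / 2)) as [d Hd]; [lra|].
    set (h := Rmin (d / 2) (x - m)).
    assert (Hd0 := cond_pos d).
    assert (Hh0 : 0 < h) by (apply Rmin_glb_lt; lra).
    assert (Hh1 : h <= d / 2) by apply Rmin_l.
    assert (Hh2 : h <= x - m) by apply Rmin_r.
    specialize (Hd h ltac:(lra)). rewrite (Rabs_pos_eq h) in Hd by lra.
    specialize (Hd ltac:(lra)). apply Rabs_def2 in Hd.
    assert (H1 : k / 2 < (J (m + h) - J m) / h) by lra.
    apply (Rmult_lt_compat_r h) in H1; [|lra].
    unfold Rdiv in H1. rewrite Rmult_assoc, (Rmult_assoc _ (/ h)), Rinv_l in H1 by lra.
    assert (H2 := Hm (m + h) ltac:(lra)). nra. }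
  (* Growth at rate [k] over the length [T] lifts [J] from [J x0] to at least [B + 1], beyond its
     bound. *)
  set (T := (B - J x0 + 1) / k).
  assert (HT : 0 < T).
  { apply Rdiv_lt_0_compat; [specialize (HB x0); lra | lra]. }
  destruct (MVT_gen J x0 (x0 + T) J') as [y [Hy Heq]].
  - intros; apply HJ.
  - intros t _. apply (is_derive_continuity_pt J t (J' t)), HJ.
  - rewrite Rmin_left, Rmax_right in Hy by lra.
    assert (H1 := Hg y (Rle_trans _ _ _ Hc (Hmon y (proj1 Hy)))).
    assert (H2 := HB (x0 + T)).
    replace (x0 + T - x0) with T in Heq by ring.
    assert (H3 : k * T = B - J x0 + 1) by (unfold T; field; lra).
    nra.
Qed.

(** * Implicit differentiation and two-variable calculus on the strip *)

(** The level curve is given and continuous, so only its slope is at stake. Linearising [f] first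
    shows that the increment [D] of [h] is at most [K |k|]; the same linearisation then makes
    [a k + b D] negligible against [k]. *)
Lemma implicit_derive (f : R -> R -> R) (h : R -> R) (x a b : R) :
  differentiable_pt_lim f x (h x) a b -> 0 < b ->
  (forall t, f t (h t) = f x (h x)) -> continuity_pt h x ->
  is_derive h x (- (a / b)).
Proof.
  intros Hf Hb Hlev Hh.
  apply is_derive_Reals. intros eps Heps.
  (* With an error factor [e <= b / 2], solving the linearised equation for [|D|] gives exactly this
     constant; the second bound on [e] makes the final error at most [eps / 2]. *)
  set (K := 2 * Rabs a / b + 1).
  assert (HK : 1 <= K).
  { unfold K. assert (0 <= 2 * Rabs a / b); [|lra].
    apply Rdiv_le_0_compat; [|lra]. assert (H := Rabs_pos a); lra. }
  assert (He : 0 < Rmin (b / 2) (eps * b / (2 * (1 + K)))).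
  { apply Rmin_glb_lt; [lra|]. apply Rdiv_lt_0_compat; nra. }
  set (e := mkposreal _ He).
  assert (He1 : e <= b / 2) by apply Rmin_l.
  assert (He2 : e <= eps * b / (2 * (1 + K))) by apply Rmin_r.
  assert (He0 := cond_pos e).
  destruct (Hf e) as [d Hd]. assert (Hd0 := cond_pos d).
  destruct (Hh d Hd0) as [d' [Hd'0 Hd']].
  assert (Hm : 0 < Rmin d d') by (apply Rmin_glb_lt; lra).
  exists (mkposreal _ Hm). intros k Hk Hkd. simpl in Hkd.
  assert (Hk1 : Rabs k < d) by (eapply Rlt_le_trans; [exact Hkd | apply Rmin_l]).
  assert (Hk2 : Rabs k < d') by (eapply Rlt_le_trans; [exact Hkd | apply Rmin_r]).
  assert (HD : Rabs (h (x + k) - h x) < d).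
  { apply Hd'. split; [split; [exact I | lra]|].
    simpl. unfold Rdist. replace (x + k - x) with k by ring. exact Hk2. }
  specialize (Hd (x + k) (h (x + k))).
  replace (x + k - x) with k in Hd by ring.
  specialize (Hd Hk1 HD). rewrite (Hlev (x + k)) in Hd.
  set (D := h (x + k) - h x) in *.
  assert (Hk0 : 0 < Rabs k) by now apply Rabs_pos_lt.
  assert (HD0 := Rabs_pos D).
  assert (H1 : Rabs (a * k + b * D) <= e * (Rabs k + Rabs D)).
  { replace (a * k + b * D) with (- (f x (h x) - f x (h x) - (a * k + b * D))) by ring.
    rewrite Rabs_Ropp. eapply Rle_trans; [exact Hd|].
    apply Rmult_le_compat_l; [lra|]. apply Rmax_lub; lra. }
  assert (H2 : b * Rabs D <= Rabs (a * k + b * D) + Rabs a * Rabs k).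
  { rewrite <- (Rabs_pos_eq b) at 1 by lra. rewrite <- !Rabs_mult.
    replace (b * D) with ((a * k + b * D) + - (a * k)) at 1 by ring.
    eapply Rle_trans; [apply Rabs_triang|]. rewrite Rabs_Ropp. lra. }
  assert (H3 : Rabs D <= K * Rabs k).
  { assert (HbK : b * K = 2 * Rabs a + b) by (unfold K; field; lra).
    assert (e * (Rabs k + Rabs D) <= b / 2 * (Rabs k + Rabs D))
      by (apply Rmult_le_compat_r; lra).
    apply Rmult_le_reg_l with b; [lra|]. nra. }
  assert (H4 : Rabs (a * k + b * D) <= eps * b / 2 * Rabs k).
  { eapply Rle_trans; [exact H1|].
    apply Rle_trans with (e * ((1 + K) * Rabs k)); [apply Rmult_le_compat_l; lra|].
    apply Rle_trans with (eps * b / (2 * (1 + K)) * ((1 + K) * Rabs k)).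
    - apply Rmult_le_compat_r; [nra | lra].
    - right. field. lra. }
  replace (D / k - - (a / b)) with ((a * k + b * D) / (b * k)) by (field; lra).
  unfold Rdiv. rewrite Rabs_mult, Rabs_inv, Rabs_mult, (Rabs_pos_eq b) by lra.
  assert (Hbk : 0 < b * Rabs k) by now apply Rmult_lt_0_compat.
  apply Rmult_lt_reg_r with (b * Rabs k); [exact Hbk|].
  rewrite Rmult_assoc, Rinv_l by lra. nra.
Qed.

Lemma locally_2d_strip (x y : R) : strip x y -> locally_2d strip x y.
Proof.
  intros [H0 H1].
  assert (H : 0 < Rmin y (1 - y)) by (apply Rmin_glb_lt; lra).
  exists (mkposreal _ H). simpl. intros u v _ Hv.
  assert (H2 := Rmin_l y (1 - y)). assert (H3 := Rmin_r y (1 - y)).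
  apply Rabs_def2 in Hv. unfold strip. lra.
Qed.

Lemma continuity_2d_pt_section (f : R -> R -> R) (x y : R) :
  continuity_2d_pt f x y -> continuous (f x) y.
Proof.
  intros H. apply continuity_pt_filterlim. intros eps Heps.
  destruct (H (mkposreal _ Heps)) as [d Hd]. exists d. split; [apply cond_pos|].
  intros t [_ Ht]. apply (Hd x t); [|exact Ht].
  replace (x - x) with 0 by ring. rewrite Rabs_R0. apply cond_pos.
Qed.

Lemma differentiable_strip (f fx fy : R -> R -> R) (x y : R) :
  (forall s t, strip s t -> is_derive (fun z => f z t) s (fx s t)) ->
  (forall s t, strip s t -> is_derive (f s) t (fy s t)) ->
  (forall s t, strip s t -> continuity_2d_pt fx s t) -> strip x y ->
  differentiable_pt_lim f x y (fx x y) (fy x y).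
Proof.
  intros H1 H2 Hc Hs. apply filterdiff_differentiable_pt_lim.
  apply (is_derive_filterdiff f x y fx (fy x y)); [|now apply H2|].
  - apply (locally_2d_locally (fun s t => is_derive (fun z => f z t) s (fx s t))).
    generalize (locally_2d_strip x y Hs). apply locally_2d_impl, locally_2d_forall. exact H1.
  - now apply continuity_2d_pt_filterlim, Hc.
Qed.

Lemma lipschitz_continuity_2d_pt (f : R -> R -> R) (L : R) :
  (forall x y x' y', Rabs (f x y - f x' y') <= L * (Rabs (x - x') + Rabs (y - y'))) ->
  forall x y, continuity_2d_pt f x y.
Proof.
  intros Hf x y eps.
  assert (HL : 0 < Rabs L + 1) by (assert (H := Rabs_pos L); lra).
  assert (Hd : 0 < eps / (2 * (Rabs L + 1)))
    by (apply Rdiv_lt_0_compat; [apply cond_pos | lra]).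
  exists (mkposreal _ Hd). simpl. intros u v Hu Hv.
  eapply Rle_lt_trans; [apply Hf|].
  assert (H0 := Rabs_pos (u - x)). assert (H1 := Rabs_pos (v - y)).
  assert (H2 := Rle_abs L).
  replace (pos eps) with ((Rabs L + 1) * (2 * (eps / (2 * (Rabs L + 1))))) by (field; lra).
  apply Rle_lt_trans with ((Rabs L + 1) * (Rabs (u - x) + Rabs (v - y))).
  - apply Rmult_le_compat_r; lra.
  - apply Rmult_lt_compat_l; lra.
Qed.

(** Let [e] tend to [0]. Identities valid only in the open strip are carried to the walls, and
    upstream limits are taken, through this lemma. *)
Lemma Rle_0_of_small (A C : R) : (forall e, 0 < e < 1 -> A <= C * e) -> A <= 0.
Proof.
  intros H. apply Rnot_lt_le. intros HA.
  assert (HC : 0 < C) by (specialize (H (1 / 2) ltac:(lra)); lra).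
  assert (Hq : 0 < A / (A + 2 * C)) by (apply Rdiv_lt_0_compat; lra).
  assert (Hq1 : A / (A + 2 * C) * (A + 2 * C) = A) by (field; lra).
  set (q := A / (A + 2 * C)) in *.
  specialize (H q ltac:(split; nra)). nra.
Qed.

(** Differentiation under the integral sign. Both ends lie strictly inside [(0, 1)], where the
    derivatives are continuous; integrals up to a wall are reached by truncation. *)
Lemma is_derive_RInt_strip (f fx : R -> R -> R) (a b x : R) :
  0 < a < 1 -> 0 < b < 1 ->
  (forall s t, strip s t -> is_derive (fun z => f z t) s (fx s t)) ->
  (forall s t, strip s t -> continuity_2d_pt fx s t) ->
  (forall s t, strip s t -> continuity_2d_pt f s t) ->
  is_derive (fun s => RInt (f s) a b) x (RInt (fx x) a b).
Proof.
  intros Ha Hb Hd Hc Hf.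
  assert (Hs : forall t s, Rmin a b <= t <= Rmax a b -> strip s t).
  { intros t s. unfold strip, Rmin, Rmax. destruct Rle_dec; lra. }
  replace (RInt (fx x) a b) with (RInt (fun t => Derive (fun u => f u t) x) a b).
  - apply (is_derive_RInt_param f).
    + apply filter_forall. intros s t Ht. exists (fx s t). apply Hd, Hs, Ht.
    + intros t Ht. apply (continuity_2d_pt_ext_loc fx); [|apply Hc, Hs, Ht].
      generalize (locally_2d_strip x t (Hs t x Ht)). apply locally_2d_impl.
      apply locally_2d_forall. intros u v Huv. symmetry. now apply is_derive_unique, Hd.
    + apply filter_forall. intros s. apply (ex_RInt_continuous (V := R_CompleteNormedModule)).
      intros z Hz. now apply continuity_2d_pt_section, Hf, Hs.
  - apply RInt_ext. intros t Ht. apply is_derive_unique, Hd, Hs. lra.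
Qed.

(** * The Poiseuille stream function and its inverse *)

(** The stream function of the Poiseuille flow: a primitive of [poiseuille Q] that goes from [0] at
    the bottom wall to [Q] at the top. *)
Definition flux (Q y : R) : R := Q * (3 * y ^ 2 - 2 * y ^ 3).

(* With [y = 1/2 + sin t] one has [3 y^2 - 2 y^3 = (1 + sin (3 t)) / 2]. *)
Definition height (Q s : R) : R := 1 / 2 + sin (asin (2 * (s / Q) - 1) / 3).

Lemma is_derive_flux (Q y : R) : is_derive (flux Q) y (poiseuille Q y).
Proof. unfold flux, poiseuille. auto_derive; [trivial | ring]. Qed.

Lemma is_derive_poiseuille (Q y : R) :
  is_derive (poiseuille Q) y (6 * Q * (1 - 2 * y)).
Proof. unfold poiseuille. auto_derive; [trivial | ring]. Qed.

Lemma poiseuille_pos (Q y : R) : 0 < Q -> 0 < y < 1 -> 0 < poiseuille Q y.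
Proof.
  intros HQ Hy. unfold poiseuille.
  assert (0 < Q * y) by nra. nra.
Qed.

Lemma flux_lt (Q y z : R) : 0 < Q -> 0 <= y -> y < z -> z <= 1 -> flux Q y < flux Q z.
Proof.
  intros HQ Hy Hyz Hz. apply Rlt_0_minus.
  (* Each summand of the last factor is nonnegative on [[0, 1]], and [z (1 - y)] is positive. *)
  replace (flux Q z - flux Q y) with
    (Q * (z - y) * (2 * (y * (1 - y)) + 2 * (z * (1 - z)) + y * (1 - z) + z * (1 - y)))
    by (unfold flux; ring).
  assert (0 <= y * (1 - y)) by nra. assert (0 <= z * (1 - z)) by nra.
  assert (0 <= y * (1 - z)) by nra. assert (0 < z * (1 - y)) by nra.
  apply Rmult_lt_0_compat; [apply Rmult_lt_0_compat; lra | lra].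
Qed.

Lemma flux_inj (Q y z : R) :
  0 < Q -> 0 <= y <= 1 -> 0 <= z <= 1 -> flux Q y = flux Q z -> y = z.
Proof.
  intros HQ Hy Hz H. destruct (Rtotal_order y z) as [Hl|[He|Hg]]; [exfalso|exact He|exfalso].
  - apply (flux_lt Q) in Hl; lra.
  - apply (flux_lt Q) in Hg; lra.
Qed.

Lemma height_arg_bounds (Q s : R) : 0 < Q -> 0 < s < Q ->
  -1 < 2 * (s / Q) - 1 < 1.
Proof.
  intros HQ Hs. assert (0 < s / Q) by (apply Rdiv_lt_0_compat; lra).
  assert (s / Q < 1) by (apply Rmult_lt_reg_r with Q; [lra|]; field_simplify; lra).
  lra.
Qed.

(** The arcsine lies strictly between [-PI/2] and [PI/2], so the sine of a third of it lies strictly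
    between [-1/2] and [1/2]. *)
Lemma height_bounds (Q s : R) : 0 < Q -> 0 < s < Q ->
  0 < height Q s < 1.
Proof.
  intros HQ Hs. assert (H := asin_bound_lt _ (height_arg_bounds Q s HQ Hs)). unfold height.
  set (t := asin _) in *. assert (HP := PI_RGT_0).
  assert (H1 : sin (t / 3) < sin (PI / 6)) by (apply sin_increasing_1; lra).
  assert (H2 : sin (- (PI / 6)) < sin (t / 3)) by (apply sin_increasing_1; lra).
  rewrite sin_neg, sin_PI6 in H2. rewrite sin_PI6 in H1. lra.
Qed.

Lemma flux_height (Q s : R) : 0 < Q -> 0 < s < Q ->
  flux Q (height Q s) = s.
Proof.
  intros HQ Hs. assert (Hr := height_arg_bounds Q s HQ Hs).
  assert (H : sin (asin (2 * (s / Q) - 1)) = 2 * (s / Q) - 1) by (apply sin_asin; lra).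
  unfold height, flux. set (t := asin _) in *.
  replace t with (2 * (t / 3) + t / 3) in H by field.
  rewrite sin_plus, sin_2a, cos_2a_sin in H.
  assert (Hc := sin2_cos2 (t / 3)). unfold Rsqr in Hc.
  set (a := sin (t / 3)) in *. set (b := cos (t / 3)) in *.
  replace (3 * (1 / 2 + a) ^ 2 - 2 * (1 / 2 + a) ^ 3)
    with ((1 + (2 * a * b * b + (1 - 2 * a * a) * a)) / 2).
  - rewrite H. field. lra.
  - replace (2 * a * b * b) with (2 * a * (1 - a * a)); [field|].
    replace (1 - a * a) with (b * b) by lra. ring.
Qed.

(** The closed form yields some derivative [l]; its value then follows by differentiating
    [flux Q (height Q t) = t], without evaluating the derivative of the arcsine. *)
Lemma is_derive_height (Q s : R) : 0 < Q -> 0 < s < Q ->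
  is_derive (height Q) s (/ poiseuille Q (height Q s)).
Proof.
  intros HQ Hs. assert (Hex : exists l, is_derive (height Q) s l).
  { destruct (derivable_pt_asin _ (height_arg_bounds Q s HQ Hs)) as [l Hl].
    apply is_derive_Reals in Hl. unfold height. eexists.
    apply (is_derive_plus (fun _ => 1 / 2) (fun s => sin (asin (2 * (s / Q) - 1) / 3)));
      [apply is_derive_const|].
    apply (is_derive_comp sin); [apply is_derive_sin|].
    apply (is_derive_scal_l (K := R_AbsRing) (V := R_NormedModule)).
    apply (is_derive_comp asin (fun s => 2 * (s / Q) - 1)); [exact Hl|].
    auto_derive; [lra | reflexivity]. }
  destruct Hex as [l Hl].
  assert (HU := poiseuille_pos Q _ HQ (height_bounds Q s HQ Hs)).
  assert (H1 : is_derive (fun t => flux Q (height Q t)) s (l * poiseuille Q (height Q s))).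
  { apply (is_derive_comp (flux Q)); [apply is_derive_flux | exact Hl]. }
  replace (/ poiseuille Q (height Q s)) with l; [exact Hl|].
  apply Rmult_eq_reg_r with (poiseuille Q (height Q s)); [|lra].
  rewrite Rinv_l by lra. rewrite <- (is_derive_unique _ _ _ H1).
  apply is_derive_unique, is_derive_ext_loc with (fun t => t);
    [|exact (is_derive_id (K := R_AbsRing) s)].
  assert (Hm : 0 < Rmin s (Q - s)) by (apply Rmin_glb_lt; lra).
  exists (mkposreal _ Hm). intros t Ht. apply Rabs_def2 in Ht. simpl in Ht.
  unfold minus, plus, opp in Ht; simpl in Ht.
  assert (H2 := Rmin_l s (Q - s)). assert (H3 := Rmin_r s (Q - s)).
  symmetry. apply flux_height; lra.
Qed.

Lemma height_flux (Q y : R) : 0 < Q -> 0 < y < 1 -> height Q (flux Q y) = y.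
Proof.
  intros HQ Hy.
  assert (H0 := flux_lt Q 0 y HQ (Rle_refl 0) (proj1 Hy) (Rlt_le _ _ (proj2 Hy))).
  assert (H1 := flux_lt Q y 1 HQ (Rlt_le _ _ (proj1 Hy)) (proj2 Hy) (Rle_refl 1)).
  replace (flux Q 0) with 0 in H0 by (unfold flux; ring).
  replace (flux Q 1) with Q in H1 by (unfold flux; ring).
  assert (Hh := height_bounds Q (flux Q y) HQ (conj H0 H1)).
  apply (flux_inj Q); try lra. apply flux_height; lra.
Qed.

(* [v1, v2] is the velocity extended to the plane, [a1 = d1 v1 = - d2 v2],
   [a2 = d2 v1] and [b1 = d1 v2]. *)
Section Flow.

Variables Q M L : R.
Variables v1 v2 p a1 a2 b1 : R -> R -> R.
Hypothesis HQ : 0 < Q.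
Hypothesis HM : 0 < M.
Hypothesis HL : 0 < L.
Hypothesis Hv1 : forall x y, Rabs (v1 x y) <= M.
Hypothesis Hv2 : forall x y, Rabs (v2 x y) <= M.
Hypothesis Hl1 : forall x y x' y',
  Rabs (v1 x y - v1 x' y') <= L * (Rabs (x - x') + Rabs (y - y')).
Hypothesis Hl2 : forall x y x' y',
  Rabs (v2 x y - v2 x' y') <= L * (Rabs (x - x') + Rabs (y - y')).
Hypothesis Hbot : forall x, v2 x 0 = 0.
Hypothesis Htop : forall x, v2 x 1 = 0.
Hypothesis Hpos : forall x y, strip x y -> 0 < v1 x y.
Hypothesis Hd11 : forall x y, strip x y -> is_derive (fun t => v1 t y) x (a1 x y).
Hypothesis Hd12 : forall x y, strip x y -> is_derive (v1 x) y (a2 x y).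
Hypothesis Hd21 : forall x y, strip x y -> is_derive (fun t => v2 t y) x (b1 x y).
Hypothesis Hd22 : forall x y, strip x y -> is_derive (v2 x) y (- a1 x y).
Hypothesis Hca1 : forall x y, strip x y -> continuity_2d_pt a1 x y.
Hypothesis Hca2 : forall x y, strip x y -> continuity_2d_pt a2 x y.
Hypothesis Hcb1 : forall x y, strip x y -> continuity_2d_pt b1 x y.
Hypothesis Hpx : forall x y, strip x y ->
  is_derive (fun t => p t y) x (- (v1 x y * a1 x y + v2 x y * a2 x y)).
Hypothesis Hpy : forall x y, strip x y ->
  is_derive (p x) y (- (v1 x y * b1 x y - v2 x y * a1 x y)).
Hypothesis Hup : forall e, 0 < e -> exists X, forall x, x < X ->
  forall y, 0 <= y <= 1 -> Rabs (v1 x y - poiseuille Q y) <= e.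

(** * The stream function of the flow *)

Lemma v1_continuity_2d (x y : R) : continuity_2d_pt v1 x y.
Proof. exact (lipschitz_continuity_2d_pt v1 L Hl1 x y). Qed.

Lemma v2_continuity_2d (x y : R) : continuity_2d_pt v2 x y.
Proof. exact (lipschitz_continuity_2d_pt v2 L Hl2 x y). Qed.

Lemma v1_continuous (x y : R) : continuous (v1 x) y.
Proof. apply continuity_2d_pt_section, v1_continuity_2d. Qed.

Lemma v2_continuous (x y : R) : continuous (fun t => v2 t y) x.
Proof.
  apply (continuity_2d_pt_section (fun s t => v2 t s)). intros eps.
  destruct (v2_continuity_2d x y eps) as [d Hd]. exists d. auto.
Qed.

Lemma v1_ex_RInt (x a b : R) : ex_RInt (v1 x) a b.
Proof.
  apply (ex_RInt_continuous (V := R_CompleteNormedModule)).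
  intros; apply v1_continuous.
Qed.

Lemma v2_ex_RInt (y a b : R) : ex_RInt (fun t => v2 t y) a b.
Proof.
  apply (ex_RInt_continuous (V := R_CompleteNormedModule)).
  intros; apply v2_continuous.
Qed.

Definition psi (x y : R) : R := RInt (v1 x) 0 y.

Lemma psi_Chasles (x a b : R) : RInt (v1 x) a b = psi x b - psi x a.
Proof.
  assert (H : psi x a + RInt (v1 x) a b = psi x b)
    by exact (RInt_Chasles (v1 x) 0 a b (v1_ex_RInt _ _ _) (v1_ex_RInt _ _ _)).
  lra.
Qed.

Lemma psi_bottom (x : R) : psi x 0 = 0.
Proof. apply (RInt_point (V := R_CompleteNormedModule)). Qed.

Lemma psi_derive_2 (x y : R) : is_derive (psi x) y (v1 x y).
Proof.
  apply (is_derive_RInt (v1 x) (psi x) 0).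
  - apply filter_forall. intros t. apply (RInt_correct (V := R_CompleteNormedModule)), v1_ex_RInt.
  - apply v1_continuous.
Qed.

Lemma psi_lipschitz_2 (x y z : R) : Rabs (psi x y - psi x z) <= M * Rabs (y - z).
Proof.
  destruct (MVT_gen (psi x) z y (v1 x)) as [c [_ Hc]].
  - intros t _. apply psi_derive_2.
  - intros t _. apply (is_derive_continuity_pt _ t (v1 x t)), psi_derive_2.
  - rewrite Hc, Rabs_mult. apply Rmult_le_compat_r; [apply Rabs_pos | apply Hv1].
Qed.

Lemma psi_lt (x y z : R) : 0 <= y -> y < z -> z <= 1 -> psi x y < psi x z.
Proof.
  intros Hy Hyz Hz. apply Rlt_0_minus. rewrite <- psi_Chasles.
  apply RInt_gt_0; [exact Hyz | | intros; apply v1_continuous].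
  intros t Ht. apply Hpos. unfold strip. lra.
Qed.

Lemma abs_v2_RInt_le (y x x' K : R) : (forall t, Rabs (v2 t y) <= K) ->
  Rabs (RInt (fun t => v2 t y) x x') <= K * Rabs (x' - x).
Proof.
  intros HK.
  assert (H : forall a b, a <= b -> Rabs (RInt (fun t => v2 t y) a b) <= K * Rabs (b - a)).
  { intros a b Hab. rewrite (Rabs_pos_eq (b - a)), Rmult_comm by lra.
    apply abs_RInt_le_const; [exact Hab | apply v2_ex_RInt | auto]. }
  destruct (Rle_dec x x') as [Hx|Hx]; [now apply H|].
  rewrite <- (opp_RInt_swap (V := R_CompleteNormedModule)) by apply v2_ex_RInt.
  unfold opp; simpl. rewrite Rabs_Ropp, Rabs_minus_sym. apply H. lra.
Qed.

Lemma v2_le_bottom (x y : R) : Rabs (v2 x y) <= L * Rabs y.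
Proof.
  assert (H := Hl2 x y x 0). rewrite Hbot, !Rminus_0_r in H.
  replace (x - x) with 0 in H by ring. rewrite Rabs_R0, Rplus_0_l in H. exact H.
Qed.

Lemma v2_le_top (x y : R) : Rabs (v2 x y) <= L * Rabs (y - 1).
Proof.
  assert (H := Hl2 x y x 1). rewrite Htop, Rminus_0_r in H.
  replace (x - x) with 0 in H by ring. rewrite Rabs_R0, Rplus_0_l in H. exact H.
Qed.

(** Incompressibility: the [x]-derivative of the flux between heights [e y] and [y] is the integral
    of [a1], that is [v2] at [e y] minus [v2] at [y]. Integrating in [x] and letting [e] tend to [0]
    removes the terms at height [e y], because [v2] vanishes on the wall. *)
Lemma psi_shift (x x' y : R) : strip x y ->
  psi x' y - psi x y = - RInt (fun t => v2 t y) x x'.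
Proof.
  intros Hy. unfold strip in Hy.
  enough (H : Rabs (psi x' y - psi x y + RInt (fun t => v2 t y) x x') <= 0).
  { assert (H0 := Rabs_pos (psi x' y - psi x y + RInt (fun t => v2 t y) x x')).
    assert (H1 : psi x' y - psi x y + RInt (fun t => v2 t y) x x' = 0)
      by (apply Rabs_eq_0, Rle_antisym; assumption).
    lra. }
  (* The term [2 M] pays for the two values of [psi] at height [e y], and the other one for the
     integral of [v2] there. *)
  apply Rle_0_of_small with (2 * M + L * Rabs (x' - x)). intros e He.
  assert (Hd : forall s, is_derive (fun s => RInt (v1 s) (e * y) y) s (- (v2 s y - v2 s (e * y)))).
  { intros s.
    replace (- (v2 s y - v2 s (e * y))) with (RInt (a1 s) (e * y) y).
    - apply is_derive_RInt_strip; try (split; nra); auto using v1_continuity_2d.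
    - assert (Hi : is_RInt (a1 s) (e * y) y (minus (- v2 s y) (- v2 s (e * y)))).
      { assert (Hr : forall t, Rmin (e * y) y <= t <= Rmax (e * y) y -> strip s t).
        { intros t. rewrite Rmin_left, Rmax_right by nra. unfold strip. nra. }
        apply (is_RInt_derive (fun t => - v2 s t)).
        - intros t Ht. rewrite <- (Ropp_involutive (a1 s t)).
          apply (is_derive_opp (v2 s)), Hd22, Hr, Ht.
        - intros t Ht. apply continuity_2d_pt_section, Hca1, Hr, Ht. }
      rewrite (is_RInt_unique _ _ _ _ Hi). unfold minus, plus, opp; simpl. ring. }
  (* The same integral is evaluated twice: by the fundamental theorem here and by linearity in
     [Hj]. *)
  assert (Hi : is_RInt (fun s => - (v2 s y - v2 s (e * y))) x x'
    (minus (RInt (v1 x') (e * y) y) (RInt (v1 x) (e * y) y))).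
  { apply (is_RInt_derive (fun s => RInt (v1 s) (e * y) y)).
    - intros s _. apply Hd.
    - intros s _. apply (continuous_opp (V := R_NormedModule) (fun s => v2 s y - v2 s (e * y))).
      apply (continuous_minus (V := R_NormedModule)); apply v2_continuous. }
  assert (Hj : is_RInt (fun s => - (v2 s y - v2 s (e * y))) x x'
    (opp (minus (RInt (fun s => v2 s y) x x') (RInt (fun s => v2 s (e * y)) x x')))).
  { apply (is_RInt_opp (V := R_NormedModule)), (is_RInt_minus (V := R_NormedModule));
    apply (RInt_correct (V := R_CompleteNormedModule)), v2_ex_RInt. }
  assert (Heq := eq_trans (eq_sym (is_RInt_unique _ _ _ _ Hi)) (is_RInt_unique _ _ _ _ Hj)).
  unfold minus, plus, opp in Heq; simpl in Heq. rewrite !psi_Chasles in Heq.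
  assert (He' : 0 < e * y <= e) by nra.
  assert (H1 := psi_lipschitz_2 x (e * y) 0). assert (H2 := psi_lipschitz_2 x' (e * y) 0).
  rewrite psi_bottom, !Rminus_0_r, (Rabs_pos_eq (e * y)) in H1, H2 by lra.
  assert (H3 := abs_v2_RInt_le (e * y) x x' (L * (e * y))).
  specialize (H3 ltac:(intros t; rewrite <- (Rabs_pos_eq (e * y)) at 2 by lra; apply v2_le_bottom)).
  replace (psi x' y - psi x y + RInt (fun t => v2 t y) x x')
    with (psi x' (e * y) - psi x (e * y) + RInt (fun t => v2 t (e * y)) x x') by lra.
  assert (H4 : L * (e * y) * Rabs (x' - x) <= L * e * Rabs (x' - x)).
  { apply Rmult_le_compat_r; [apply Rabs_pos | nra]. }
  eapply Rle_trans; [apply Rabs_triang|].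
  assert (H5 := Rabs_triang (psi x' (e * y)) (- psi x (e * y))). rewrite Rabs_Ropp in H5.
  unfold Rminus at 1. nra.
Qed.

Lemma psi_derive_1 (x y : R) : strip x y -> is_derive (fun t => psi t y) x (- v2 x y).
Proof.
  intros Hy.
  apply is_derive_ext with (fun t => psi x y + - RInt (fun s => v2 s y) x t).
  { intros t. assert (H := psi_shift x t y Hy). simpl in *. lra. }
  rewrite <- (Rplus_0_l (- v2 x y)).
  apply (is_derive_plus (fun _ => psi x y)); [apply is_derive_const_R|].
  apply (is_derive_opp (fun t => RInt (fun s => v2 s y) x t)).
  apply (is_derive_RInt (fun s => v2 s y) _ x).
  - apply filter_forall. intros t. apply (RInt_correct (V := R_CompleteNormedModule)), v2_ex_RInt.
  - apply v2_continuous.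
Qed.

(** [psi] and [flux Q] agree at the bottom wall and their [y]-derivatives are uniformly close
    upstream. *)
Lemma psi_upstream (e : R) : 0 < e -> exists X, forall x, x < X ->
  forall y, 0 <= y <= 1 -> Rabs (psi x y - flux Q y) <= e.
Proof.
  intros He. destruct (Hup e He) as [X HX]. exists X. intros x Hx y Hy.
  destruct (MVT_gen (fun t => psi x t - flux Q t) 0 y (fun t => v1 x t - poiseuille Q t))
    as [c [Hc Heq]].
  - intros t _. apply (is_derive_minus (psi x)); [apply psi_derive_2 | apply is_derive_flux].
  - intros t _. eapply is_derive_continuity_pt.
    apply (is_derive_minus (psi x)); [apply psi_derive_2 | apply is_derive_flux].
  - rewrite Rmin_left, Rmax_right in Hc by lra.
    rewrite psi_bottom in Heq. replace (flux Q 0) with 0 in Heq by (unfold flux; ring).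
    rewrite !Rminus_0_r in Heq. rewrite Heq, Rabs_mult, (Rabs_pos_eq y) by lra.
    assert (H1 := HX x Hx c ltac:(lra)).
    assert (H2 := Rabs_pos (v1 x c - poiseuille Q c)). nra.
Qed.

(** The flux through a cross section does not depend on [x]: [psi_shift] at height [1 - e] involves
    only values of [v2] of size [L e]. The upstream limit identifies the constant as [Q]. *)
Lemma psi_top (x : R) : psi x 1 = Q.
Proof.
  assert (Hconst : forall x', psi x' 1 = psi x 1).
  { intros x'. apply Rminus_diag_uniq, Rabs_eq_0, Rle_antisym; [|apply Rabs_pos].
    apply Rle_0_of_small with (2 * M + L * Rabs (x' - x)). intros e He.
    assert (Hy : strip x (1 - e)) by (unfold strip; lra).
    assert (H1 := psi_shift x x' _ Hy).
    assert (H2 := abs_v2_RInt_le (1 - e) x x' (L * e)).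
    specialize (H2 ltac:(intros t; rewrite <- (Rabs_pos_eq e) at 2 by lra;
      replace (Rabs e) with (Rabs (1 - e - 1)) by
        (replace (1 - e - 1) with (- e) by ring; apply Rabs_Ropp); apply v2_le_top)).
    assert (H3 := psi_lipschitz_2 x 1 (1 - e)). assert (H4 := psi_lipschitz_2 x' 1 (1 - e)).
    replace (1 - (1 - e)) with e in H3, H4 by ring.
    rewrite (Rabs_pos_eq e) in H3, H4 by lra.
    rewrite <- (Rabs_Ropp (RInt _ _ _)), <- H1 in H2.
    revert H2 H3 H4. generalize (Rabs (x' - x)). unfold Rabs.
    repeat destruct Rcase_abs; intros; nra. }
  apply Rminus_diag_uniq, Rabs_eq_0, Rle_antisym; [|apply Rabs_pos].
  apply Rle_0_of_small with 1. intros e He.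
  destruct (psi_upstream e (proj1 He)) as [X HX].
  specialize (HX (X - 1) ltac:(lra) 1 ltac:(lra)).
  rewrite Hconst in HX. replace (flux Q 1) with Q in HX by (unfold flux; ring). lra.
Qed.

Lemma psi_bounds (x y : R) : strip x y -> 0 < psi x y < Q.
Proof.
  intros [H0 H1]. assert (Ha := psi_lt x 0 y). assert (Hb := psi_lt x y 1).
  rewrite psi_bottom in Ha. rewrite psi_top in Hb. lra.
Qed.

(** * Upstream decay of the vertical velocity and of the pressure oscillation *)

(** At fixed height [psi] is nearly constant upstream, and its [x]-derivative [- v2] is Lipschitz,
    so [derive_small_of_small] applies. *)
Lemma v2_upstream (e : R) : 0 < e -> exists X, forall x, x < X ->
  forall y, strip x y -> Rabs (v2 x y) <= e.
Proof.
  (* Over length [d] the Lipschitz error [L d d] is [e d / 2]; closeness [e d / 4] of [psi] at both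
     ends supplies the other half. *)
  intros He. set (d := e / (2 * L)).
  assert (Hd : 0 < d) by (apply Rdiv_lt_0_compat; lra).
  assert (HLd : L * d = e / 2) by (unfold d; field; lra).
  destruct (psi_upstream (e * d / 4)) as [X HX]; [nra|].
  exists (X - d). intros x Hx y Hy. unfold strip in Hy.
  assert (H := derive_small_of_small (fun t => psi t y - flux Q y) (fun t => - v2 t y)
    x d (e * d / 4) L Hd).
  cbv beta in H. rewrite Rabs_Ropp in H.
  enough (d * Rabs (v2 x y) <= d * e) by (apply Rmult_le_reg_l with d; lra).
  eapply Rle_trans; [apply H|rewrite HLd; lra].
  - intros t _. rewrite <- (Rminus_0_r (- v2 t y)).
    apply (is_derive_minus (fun t => psi t y)); [now apply psi_derive_1|].
    apply is_derive_const_R.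
  - intros t Ht. replace (- v2 t y - - v2 x y) with (- (v2 t y - v2 x y)) by ring.
    rewrite Rabs_Ropp. eapply Rle_trans; [apply Hl2|].
    replace (y - y) with 0 by ring. rewrite Rabs_R0, Rplus_0_r, Rabs_pos_eq by lra. nra.
  - apply HX; lra.
  - apply HX; lra.
Qed.

Lemma a1_bound (x y : R) : strip x y -> Rabs (a1 x y) <= L.
Proof.
  intros Hy. apply (is_derive_le_lipschitz _ _ _ _ (Hd11 x y Hy)). intros t.
  eapply Rle_trans; [apply Hl1|].
  replace (y - y) with 0 by ring. rewrite Rabs_R0, Rplus_0_r. apply Rle_refl.
Qed.

Lemma a2_bound (x y : R) : strip x y -> Rabs (a2 x y) <= L.
Proof.
  intros Hy. apply (is_derive_le_lipschitz _ _ _ _ (Hd12 x y Hy)). intros t.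
  eapply Rle_trans; [apply Hl1|].
  replace (x - x) with 0 by ring. rewrite Rabs_R0, Rplus_0_l. apply Rle_refl.
Qed.

Lemma p_lipschitz_1 (x x' y : R) : strip x y ->
  Rabs (p x' y - p x y) <= 2 * M * L * Rabs (x' - x).
Proof.
  intros Hy.
  destruct (MVT_gen (fun t => p t y) x x' (fun x => - (v1 x y * a1 x y + v2 x y * a2 x y)))
    as [c [_ Hc]].
  - intros t _. apply Hpx, Hy.
  - intros t _. eapply is_derive_continuity_pt. apply Hpx, Hy.
  - rewrite Hc, Rabs_mult. apply Rmult_le_compat_r; [apply Rabs_pos|].
    rewrite Rabs_Ropp. eapply Rle_trans; [apply Rabs_triang|]. rewrite !Rabs_mult.
    assert (Rabs (v1 c y) * Rabs (a1 c y) <= M * L)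
      by (apply Rmult_le_compat; auto using Rabs_pos, a1_bound).
    assert (Rabs (v2 c y) * Rabs (a2 c y) <= M * L)
      by (apply Rmult_le_compat; auto using Rabs_pos, a2_bound).
    lra.
Qed.

(** The vertical momentum equation in divergence form, [d1 (v1 v2) = - d2 (p + v2^2)], integrated
    from [y] to [z]. *)
Lemma momentum_flux_derive_1 (x y z : R) : 0 < y < 1 -> 0 < z < 1 ->
  is_derive (fun t => RInt (fun s => v1 t s * v2 t s) y z) x
    (- (p x z + v2 x z * v2 x z - (p x y + v2 x y * v2 x y))).
Proof.
  intros Hy Hz.
  assert (Hr : forall t, Rmin y z <= t <= Rmax y z -> strip x t).
  { intros t. unfold strip, Rmin, Rmax. destruct Rle_dec; lra. }
  set (fx := fun s t => a1 s t * v2 s t + v1 s t * b1 s t).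
  assert (Hfx : forall s t, strip s t -> continuity_2d_pt fx s t).
  { intros s t Ht. apply continuity_2d_pt_plus; apply continuity_2d_pt_mult;
      auto using v1_continuity_2d, v2_continuity_2d. }
  replace (- _) with (RInt (fx x) y z).
  - apply (is_derive_RInt_strip (fun s t => v1 s t * v2 s t) fx); auto.
    + intros s t Ht.
      apply (is_derive_Rmult (fun u => v1 u t) (fun u => v2 u t)); auto.
    + intros s t Ht. apply continuity_2d_pt_mult; auto using v1_continuity_2d, v2_continuity_2d.
  - apply (is_RInt_unique (fx x)).
    replace (- _) with (minus (- (p x z + v2 x z * v2 x z)) (- (p x y + v2 x y * v2 x y)))
      by (unfold minus, plus, opp; simpl; ring).
    apply (is_RInt_derive (fun t => - (p x t + v2 x t * v2 x t))).
    + intros t Ht. specialize (Hr t Ht).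
      replace (fx x t) with (- (- (v1 x t * b1 x t - v2 x t * a1 x t)
        + (- a1 x t * v2 x t + v2 x t * - a1 x t))) by (unfold fx; ring).
      apply (is_derive_opp (fun t => p x t + v2 x t * v2 x t)).
      apply (is_derive_plus (p x) (fun t => v2 x t * v2 x t)); [now apply Hpy|].
      apply (is_derive_Rmult (v2 x) (v2 x)); now apply Hd22.
    + intros t Ht. now apply continuity_2d_pt_section, Hfx, Hr.
Qed.

Lemma sqr_diff_le (a b d : R) : Rabs a <= M -> Rabs b <= M -> Rabs (a - b) <= d ->
  Rabs (a * a - b * b) <= 2 * M * d.
Proof.
  intros Ha Hb Hd. replace (a * a - b * b) with ((a + b) * (a - b)) by ring.
  rewrite Rabs_mult. apply Rmult_le_compat; auto using Rabs_pos.
  eapply Rle_trans; [apply Rabs_triang | lra].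
Qed.

Lemma v2_lipschitz_1 (x x' y : R) : Rabs (v2 x y - v2 x' y) <= L * Rabs (x - x').
Proof.
  eapply Rle_trans; [apply Hl2|].
  replace (y - y) with 0 by ring. rewrite Rabs_R0, Rplus_0_r. apply Rle_refl.
Qed.

(** The vertical momentum flux through a segment tends to [0] with [v2], and its [x]-derivative is
    Lipschitz, so that derivative tends to [0] too. Up to squares of [v2] it is the pressure
    difference between the ends. *)
Lemma p_upstream (e : R) : 0 < e -> exists X, forall x, x < X ->
  forall y z, strip x y -> strip x z -> Rabs (p x y - p x z) <= e.
Proof.
  (* The derivative [g] has Lipschitz constant [8 M L]: two pressure terms and two squares of [v2]
     contribute [2 M L] each. The bound [n] on [|v2|] is then chosen to make the flux at most
     [e d / 8] and each square at most [e / 8]. *)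
  intros He. set (d := e / (32 * M * L)).
  assert (HML : 0 < M * L) by nra.
  assert (Hd : 0 < d) by (apply Rdiv_lt_0_compat; lra).
  assert (HCd : 8 * M * L * d = e / 4) by (unfold d; field; lra).
  assert (Hm : 0 < Rmin (e * d / (8 * M)) (e / (8 * M))).
  { apply Rmin_glb_lt; apply Rdiv_lt_0_compat; nra. }
  set (n := Rmin (e * d / (8 * M)) (e / (8 * M))) in *.
  assert (Hn1 : n * M <= e * d / 8).
  { apply Rle_trans with (e * d / (8 * M) * M); [|right; field; lra].
    apply Rmult_le_compat_r; [lra | apply Rmin_l]. }
  assert (Hn2 : n * M <= e / 8).
  { apply Rle_trans with (e / (8 * M) * M); [|right; field; lra].
    apply Rmult_le_compat_r; [lra | apply Rmin_r]. }
  destruct (v2_upstream n Hm) as [X HX].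
  exists (X - d). intros x Hx.
  enough (Hle : forall y z, 0 < y < 1 -> 0 < z < 1 -> y <= z -> Rabs (p x z - p x y) <= e).
  { intros y z Hy Hz. destruct (Rle_dec y z) as [Hyz|Hyz].
    - rewrite Rabs_minus_sym. apply Hle; auto.
    - apply Hle; auto; lra. }
  intros y z Hy Hz Hyz.
  set (g := fun t => - (p t z + v2 t z * v2 t z - (p t y + v2 t y * v2 t y))).
  assert (HA : forall t, t < X -> Rabs (RInt (fun s => v1 t s * v2 t s) y z) <= e * d / 8).
  { intros t Ht. eapply Rle_trans; [apply abs_RInt_le_const with (M := n * M)|].
    - exact Hyz.
    - apply (ex_RInt_continuous (V := R_CompleteNormedModule)). intros s _.
      apply (continuity_2d_pt_section (fun t s => v1 t s * v2 t s)).
      apply continuity_2d_pt_mult; [apply v1_continuity_2d | apply v2_continuity_2d].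
    - intros s Hs. rewrite Rabs_mult, Rmult_comm.
      apply Rmult_le_compat; auto using Rabs_pos. apply HX; [exact Ht | unfold strip; lra].
    - assert (0 < n * M) by now apply Rmult_lt_0_compat. nra. }
  assert (H := derive_small_of_small (fun t => RInt (fun s => v1 t s * v2 t s) y z) g
    x d (e * d / 8) (8 * M * L) Hd).
  assert (Hg : Rabs (g x) <= e / 2).
  { apply Rmult_le_reg_l with d; [lra|].
    eapply Rle_trans; [apply H|rewrite HCd; lra].
    - intros t _. now apply momentum_flux_derive_1.
    - intros t Ht. unfold g.
      assert (Ep : forall y, 0 < y < 1 -> Rabs (p t y - p x y) <= 2 * M * L * d).
      { intros w Hw. eapply Rle_trans; [now apply p_lipschitz_1|].
        rewrite Rabs_pos_eq by lra. nra. }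
      assert (Ev : forall y, Rabs (v2 t y * v2 t y - v2 x y * v2 x y) <= 2 * M * (L * d)).
      { intros w. apply sqr_diff_le; auto.
        eapply Rle_trans; [apply v2_lipschitz_1|]. rewrite Rabs_pos_eq by lra. nra. }
      assert (E1 := Ep y Hy). assert (E2 := Ep z Hz).
      assert (E3 := Ev y). assert (E4 := Ev z).
      revert E1 E2 E3 E4. unfold Rabs. repeat destruct Rcase_abs; intros; lra.
    - apply HA. lra.
    - apply HA. lra. }
  assert (Hsq : forall w, 0 < w < 1 -> 0 <= v2 x w * v2 x w <= e / 8).
  { intros w Hw. split; [nra|]. eapply Rle_trans; [|exact Hn2].
    rewrite <- (Rabs_pos_eq (v2 x w * v2 x w)), Rabs_mult by nra.
    apply Rmult_le_compat; auto using Rabs_pos. apply HX; [lra | exact Hw]. }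
  assert (Hy2 := Hsq y Hy). assert (Hz2 := Hsq z Hz). unfold g in Hg.
  revert Hg. unfold Rabs. repeat destruct Rcase_abs; intros; lra.
Qed.

(** * Streamlines and the Bernoulli law *)

Definition bernoulli (x y : R) : R :=
  p x y + (v1 x y * v1 x y + v2 x y * v2 x y) / 2.

(** With the vorticity [b1 - a2], the gradient of [bernoulli] is the vorticity times [(v2, - v1)],
    hence orthogonal to the velocity. *)
Lemma bernoulli_derive_1 (x y : R) : strip x y ->
  is_derive (fun t => bernoulli t y) x (v2 x y * (b1 x y - a2 x y)).
Proof.
  intros Hy. unfold bernoulli.
  replace (v2 x y * (b1 x y - a2 x y)) with
    (- (v1 x y * a1 x y + v2 x y * a2 x y) +
      ((a1 x y * v1 x y + v1 x y * a1 x y) + (b1 x y * v2 x y + v2 x y * b1 x y)) * / 2)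
    by field.
  apply (is_derive_plus (fun t => p t y)); [now apply Hpx|].
  apply (is_derive_scal_l (K := R_AbsRing) (V := R_NormedModule)).
  apply (is_derive_plus (fun t => v1 t y * v1 t y) (fun t => v2 t y * v2 t y)).
  - apply (is_derive_Rmult (fun t => v1 t y) (fun t => v1 t y)); auto.
  - apply (is_derive_Rmult (fun t => v2 t y) (fun t => v2 t y)); auto.
Qed.

Lemma bernoulli_derive_2 (x y : R) : strip x y ->
  is_derive (bernoulli x) y (v1 x y * (a2 x y - b1 x y)).
Proof.
  intros Hy. unfold bernoulli.
  replace (v1 x y * (a2 x y - b1 x y)) with
    (- (v1 x y * b1 x y - v2 x y * a1 x y) +
      ((a2 x y * v1 x y + v1 x y * a2 x y) + (- a1 x y * v2 x y + v2 x y * - a1 x y)) * / 2)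
    by field.
  apply (is_derive_plus (p x)); [now apply Hpy|].
  apply (is_derive_scal_l (K := R_AbsRing) (V := R_NormedModule)).
  apply (is_derive_plus (fun t => v1 x t * v1 x t) (fun t => v2 x t * v2 x t)).
  - apply (is_derive_Rmult (v1 x) (v1 x)); auto.
  - apply (is_derive_Rmult (v2 x) (v2 x)); auto.
Qed.

Lemma streamline_exists (s : R) : 0 < s < Q ->
  exists h : R -> R, forall x, 0 < h x < 1 /\ psi x (h x) = s.
Proof.
  intros Hs.
  (* The root comes as a [sig], so the streamline is a function of [x] obtained without a choice
     axiom. *)
  assert (H : forall x, {y | Rmin 0 1 <= y <= Rmax 0 1 /\ psi x y = s}).
  { intros x. apply IVT_gen.
    - intros y. apply (is_derive_continuity_pt _ _ _ (psi_derive_2 x y)).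
    - rewrite psi_bottom, psi_top, Rmin_left, Rmax_right; lra. }
  exists (fun x => proj1_sig (H x)). intros x.
  destruct (H x) as [y [Hy Heq]]; simpl.
  rewrite Rmin_left, Rmax_right in Hy by lra. split; [|exact Heq].
  assert (y <> 0) by (intros ->; rewrite psi_bottom in Heq; lra).
  assert (y <> 1) by (intros ->; rewrite psi_top in Heq; lra).
  lra.
Qed.

Section Streamline.

Variable s : R.
Variable h : R -> R.
Hypothesis Hs : 0 < s < Q.
Hypothesis Hh : forall x, 0 < h x < 1 /\ psi x (h x) = s.

(** [psi x] takes values strictly below and above [s] at heights [h x - e] and [h x + e]. This
    persists for nearby abscissae, and monotonicity in [y] traps the streamline between these
    heights. *)
Lemma streamline_continuous (x : R) : continuity_pt h x.
Proof.
  intros eps Heps. destruct (Hh x) as [Hx Hpx0].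
  set (e := Rmin eps (Rmin (h x) (1 - h x)) / 2).
  assert (He : 0 < e /\ e < eps /\ e < h x /\ e < 1 - h x).
  { unfold e. assert (H1 := Rmin_l eps (Rmin (h x) (1 - h x))).
    assert (H2 := Rmin_r eps (Rmin (h x) (1 - h x))).
    assert (H3 := Rmin_l (h x) (1 - h x)). assert (H4 := Rmin_r (h x) (1 - h x)).
    assert (0 < Rmin eps (Rmin (h x) (1 - h x))) by (repeat apply Rmin_glb_lt; lra). lra. }
  assert (Hlo := psi_lt x (h x - e) (h x)). assert (Hhi := psi_lt x (h x) (h x + e)).
  assert (Hcont : forall y, strip x y -> continuity_pt (fun t => psi t y) x)
    by (intros y Hy; eapply is_derive_continuity_pt, psi_derive_1, Hy).
  destruct (Hcont (h x - e) ltac:(unfold strip; lra) (s - psi x (h x - e)) ltac:(lra))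
    as [d1 [Hd1 Hc1]].
  destruct (Hcont (h x + e) ltac:(unfold strip; lra) (psi x (h x + e) - s) ltac:(lra))
    as [d2 [Hd2 Hc2]].
  exists (Rmin d1 d2). split; [apply Rmin_glb_lt; lra|].
  intros t [Ht0 Ht]. simpl in *. unfold Rdist in *.
  specialize (Hc1 t (conj Ht0 (Rlt_le_trans _ _ _ Ht (Rmin_l _ _)))).
  specialize (Hc2 t (conj Ht0 (Rlt_le_trans _ _ _ Ht (Rmin_r _ _)))).
  apply Rabs_def2 in Hc1. apply Rabs_def2 in Hc2.
  destruct (Hh t) as [Hht Hpt].
  assert (h x - e < h t).
  { apply Rnot_le_lt. intros [Hlt|Heq].
    - apply (psi_lt t) in Hlt; lra.
    - rewrite <- Heq in Hc1. lra. }
  assert (h t < h x + e).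
  { apply Rnot_le_lt. intros [Hlt|Heq].
    - apply (psi_lt t) in Hlt; lra.
    - rewrite Heq in Hc2. lra. }
  apply Rabs_def1; lra.
Qed.

Lemma streamline_derive (x : R) : is_derive h x (v2 x (h x) / v1 x (h x)).
Proof.
  destruct (Hh x) as [Hx Hpx0].
  replace (v2 x (h x) / v1 x (h x)) with (- (- v2 x (h x) / v1 x (h x)))
    by (field; apply Rgt_not_eq, Hpos, Hx).
  apply (implicit_derive psi).
  - apply (differentiable_strip psi (fun x y => - v2 x y) v1).
    + exact psi_derive_1.
    + intros; apply psi_derive_2.
    + intros; apply continuity_2d_pt_opp, v2_continuity_2d.
    + exact Hx.
  - apply Hpos, Hx.
  - intros t. rewrite Hpx0. apply Hh.
  - apply streamline_continuous.
Qed.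

(** The tangent [(1, v2 / v1)] is parallel to the velocity, to which the gradient of [bernoulli] is
    orthogonal. *)
Lemma bernoulli_streamline (x x' : R) : bernoulli x' (h x') = bernoulli x (h x).
Proof.
  assert (Hd : forall t, is_derive (fun t => bernoulli t (h t)) t 0).
  { intros t. destruct (Hh t) as [Ht _].
    apply is_derive_Reals.
    replace 0 with (v2 t (h t) * (b1 t (h t) - a2 t (h t)) * 1 +
      v1 t (h t) * (a2 t (h t) - b1 t (h t)) * (v2 t (h t) / v1 t (h t)))
      by (field; apply Rgt_not_eq, Hpos, Ht).
    apply (derivable_pt_lim_comp_2d bernoulli (fun t => t) h).
    - apply (differentiable_strip bernoulli (fun x y => v2 x y * (b1 x y - a2 x y))
        (fun x y => v1 x y * (a2 x y - b1 x y))).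
      + exact bernoulli_derive_1.
      + exact bernoulli_derive_2.
      + intros. apply continuity_2d_pt_mult; [apply v2_continuity_2d|].
        apply continuity_2d_pt_minus; auto.
      + exact Ht.
    - apply derivable_pt_lim_id.
    - apply is_derive_Reals, streamline_derive. }
  destruct (MVT_gen (fun t => bernoulli t (h t)) x x' (fun _ => 0)) as [c [_ Hc]].
  - intros t _. apply Hd.
  - intros t _. apply (is_derive_continuity_pt _ _ _ (Hd t)).
  - lra.
Qed.

(** Far upstream [flux Q (h x)] approaches [psi x (h x) = s], so the streamline approaches
    [height Q s]. There [v1] tends to the Poiseuille velocity and [v2] to [0]. *)
Lemma bernoulli_upstream (e : R) : 0 < e -> exists X, forall x, x < X ->
  Rabs (bernoulli x (h x) - p x (h x) - poiseuille Q (height Q s) ^ 2 / 2) <= e.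
Proof.
  intros He. set (W := fun t => poiseuille Q (height Q t)).
  (* The kinetic error is at most [n (M + 6 Q) + n M / 2], since [|v1 - W s| <= 2 n] and
     [W s <= 6 Q]. *)
  set (n := e / (2 * M + 6 * Q)).
  assert (Hn : 0 < n) by (apply Rdiv_lt_0_compat; lra).
  assert (Hne : n * (2 * M + 6 * Q) = e) by (unfold n; field; lra).
  assert (HW : continuity_pt W s).
  { eapply is_derive_continuity_pt, (is_derive_comp (poiseuille Q)).
    - apply is_derive_poiseuille.
    - now apply is_derive_height. }
  destruct (HW n Hn) as [d [Hd0 Hd]]. simpl in Hd. unfold Rdist in Hd.
  destruct (Hup n Hn) as [X1 HX1].
  destruct (v2_upstream n Hn) as [X2 HX2].
  destruct (psi_upstream (d / 2)) as [X3 HX3]; [lra|].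
  exists (Rmin X1 (Rmin X2 X3)). intros x Hx.
  assert (E1 := Rmin_l X1 (Rmin X2 X3)). assert (E2 := Rmin_r X1 (Rmin X2 X3)).
  assert (E3 := Rmin_l X2 X3). assert (E4 := Rmin_r X2 X3).
  destruct (Hh x) as [Hhx Hpx0].
  specialize (HX1 x ltac:(lra) (h x) ltac:(lra)).
  specialize (HX2 x ltac:(lra) (h x) Hhx).
  specialize (HX3 x ltac:(lra) (h x) ltac:(lra)). rewrite Hpx0 in HX3.
  assert (HWh : Rabs (poiseuille Q (h x) - W s) <= n).
  { rewrite <- (height_flux Q (h x)) by assumption.
    (* [continuity_pt] speaks only of points different from [s], so equality is a separate case. *)
    destruct (Req_dec (flux Q (h x)) s) as [->|Hne'].
    - unfold W. rewrite Rminus_diag, Rabs_R0. lra.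
    - left. apply (Hd (flux Q (h x))). split; [split; [exact I | auto]|].
      rewrite Rabs_minus_sym. lra. }
  assert (HWs : 0 <= W s <= 6 * Q).
  { assert (H1 := height_bounds Q s HQ Hs). split; [left; now apply poiseuille_pos|].
    unfold W, poiseuille. set (y := height Q s) in *.
    assert (y * (1 - y) <= 1) by nra. nra. }
  assert (Hv1W : Rabs (v1 x (h x) - W s) <= 2 * n).
  { revert HX1 HWh. unfold Rabs. repeat destruct Rcase_abs; lra. }
  unfold bernoulli. fold (W s).
  replace (p x (h x) + (v1 x (h x) * v1 x (h x) + v2 x (h x) * v2 x (h x)) / 2
    - p x (h x) - W s ^ 2 / 2)
    with ((v1 x (h x) - W s) * ((v1 x (h x) + W s) / 2) + v2 x (h x) * (v2 x (h x) / 2))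
    by field.
  eapply Rle_trans; [apply Rabs_triang|]. rewrite !Rabs_mult.
  assert (F1 : Rabs ((v1 x (h x) + W s) / 2) <= (M + 6 * Q) / 2).
  { assert (F := Hv1 x (h x)). revert F. unfold Rabs. repeat destruct Rcase_abs; lra. }
  assert (F2 : Rabs (v2 x (h x) / 2) <= M / 2).
  { assert (F := Hv2 x (h x)). revert F. unfold Rabs. repeat destruct Rcase_abs; lra. }
  assert (G1 : Rabs (v1 x (h x) - W s) * Rabs ((v1 x (h x) + W s) / 2)
    <= 2 * n * ((M + 6 * Q) / 2)) by (apply Rmult_le_compat; auto using Rabs_pos).
  assert (G2 : Rabs (v2 x (h x)) * Rabs (v2 x (h x) / 2)
    <= n * (M / 2)) by (apply Rmult_le_compat; auto using Rabs_pos).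
  nra.
Qed.

End Streamline.

(** Both points are followed upstream along their streamlines, which changes neither [bernoulli] nor
    the stream value. There each side is the pressure up to [e], and the two pressures differ by at
    most [e]: three errors in all. *)
Lemma bernoulli_section (x y z : R) : strip x y -> strip x z ->
  bernoulli x y - poiseuille Q (height Q (psi x y)) ^ 2 / 2 =
  bernoulli x z - poiseuille Q (height Q (psi x z)) ^ 2 / 2.
Proof.
  assert (Hthrough : forall y, strip x y -> exists h : R -> R,
    h x = y /\ forall t, 0 < h t < 1 /\ psi t (h t) = psi x y).
  { intros w Hw. destruct (streamline_exists (psi x w) (psi_bounds x w Hw)) as [h Hh].
    exists h. split; [|exact Hh]. destruct (Hh x) as [H1 H2]. unfold strip in Hw.
    destruct (Rtotal_order (h x) w) as [Hl|[He|Hg]]; [exfalso|exact He|exfalso].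
    - apply (psi_lt x) in Hl; lra.
    - apply (psi_lt x) in Hg; lra. }
  intros Hy Hz. destruct (Hthrough y Hy) as [h [Hhx Hh]].
  destruct (Hthrough z Hz) as [k [Hkx Hk]].
  apply Rminus_diag_uniq, Rabs_eq_0, Rle_antisym; [|apply Rabs_pos].
  apply Rle_0_of_small with 3. intros e He.
  destruct (bernoulli_upstream _ h (psi_bounds x y Hy) Hh e) as [X1 HX1]; [lra|].
  destruct (bernoulli_upstream _ k (psi_bounds x z Hz) Hk e) as [X2 HX2]; [lra|].
  destruct (p_upstream e) as [X3 HX3]; [lra|].
  set (t := Rmin X1 (Rmin X2 X3) - 1).
  assert (E1 := Rmin_l X1 (Rmin X2 X3)). assert (E2 := Rmin_r X1 (Rmin X2 X3)).
  assert (E3 := Rmin_l X2 X3). assert (E4 := Rmin_r X2 X3).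
  specialize (HX1 t ltac:(unfold t; lra)). specialize (HX2 t ltac:(unfold t; lra)).
  specialize (HX3 t ltac:(unfold t; lra) (h t) (k t) (proj1 (Hh t)) (proj1 (Hk t))).
  assert (B1 := bernoulli_streamline _ h Hh x t). rewrite Hhx in B1.
  assert (B2 := bernoulli_streamline _ k Hk x t). rewrite Hkx in B2.
  rewrite <- B1, <- B2. revert HX1 HX2 HX3. unfold Rabs.
  repeat destruct Rcase_abs; intros; lra.
Qed.

(** * The Poiseuille height of the stream value and the reduced pressure [q] *)

Definition Y (x y : R) : R := height Q (psi x y).

Lemma Y_bounds (x y : R) : strip x y -> 0 < Y x y < 1.
Proof. intros Hy. now apply height_bounds, psi_bounds. Qed.

Lemma poiseuille_Y_pos (x y : R) : strip x y -> 0 < poiseuille Q (Y x y).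
Proof. intros Hy. now apply poiseuille_pos, Y_bounds. Qed.

Lemma Y_derive_1 (x y : R) : strip x y ->
  is_derive (fun t => Y t y) x (- v2 x y / poiseuille Q (Y x y)).
Proof.
  intros Hy. apply (is_derive_comp (height Q) (fun t => psi t y)).
  - now apply is_derive_height, psi_bounds.
  - now apply psi_derive_1.
Qed.

Lemma Y_derive_2 (x y : R) : strip x y ->
  is_derive (Y x) y (v1 x y / poiseuille Q (Y x y)).
Proof.
  intros Hy. apply (is_derive_comp (height Q) (psi x)).
  - now apply is_derive_height, psi_bounds.
  - apply psi_derive_2.
Qed.

Lemma Y_continuity_2d (x y : R) : strip x y -> continuity_2d_pt Y x y.
Proof.
  intros Hy. apply (continuity_1d_2d_pt_comp (height Q) psi).
  - eapply is_derive_continuity_pt, is_derive_height, psi_bounds; assumption.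
  - apply differentiable_continuity_pt. exists (- v2 x y), (v1 x y).
    apply (differentiable_strip psi (fun x y => - v2 x y) v1); try assumption.
    + exact psi_derive_1.
    + intros; apply psi_derive_2.
    + intros; apply continuity_2d_pt_opp, v2_continuity_2d.
Qed.

Lemma poiseuille_Y_continuity_2d (x y : R) : strip x y ->
  continuity_2d_pt (fun s t => poiseuille Q (Y s t)) x y.
Proof.
  intros Hy. apply (continuity_1d_2d_pt_comp (poiseuille Q) Y).
  - eapply is_derive_continuity_pt, is_derive_poiseuille.
  - now apply Y_continuity_2d.
Qed.

(** On [[0, 1]] one has [flux Q w >= Q w^2], whereas [psi x e <= M e]; hence
    [Q Y^2 <= M e <= Q n^2]. The top wall is symmetric. This makes the boundary terms of the
    truncated integration by parts small, uniformly in [x]. *)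
Lemma Y_near_bottom (x e n : R) : 0 < e < 1 -> 0 < n -> e <= n -> M * e <= Q * (n * n) ->
  Rabs (e - Y x e) <= n.
Proof.
  intros He Hn Hen HMe.
  assert (HY := Y_bounds x e He).
  assert (Hf := flux_height Q (psi x e) HQ (psi_bounds x e He)). fold (Y x e) in Hf.
  assert (Hp := psi_lipschitz_2 x e 0). rewrite psi_bottom, !Rminus_0_r in Hp.
  rewrite (Rabs_pos_eq e) in Hp by lra. apply Rabs_le_between in Hp.
  assert (HYn : Y x e <= n).
  { apply Rnot_lt_le. intros Hlt. unfold flux in Hf. set (w := Y x e) in *.
    assert (Hw : Q * (w * w) <= Q * (3 * w ^ 2 - 2 * w ^ 3)).
    { apply Rminus_le_0. replace (_ - _) with (2 * Q * (1 - w) * (w * w)) by ring.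
      apply Rmult_le_pos; nra. }
    assert (Q * (n * n) < Q * (w * w)) by (apply Rmult_lt_compat_l; nra). lra. }
  apply Rabs_le. lra.
Qed.

Lemma Y_near_top (x e n : R) : 0 < e < 1 -> 0 < n -> e <= n -> M * e <= Q * (n * n) ->
  Rabs (1 - e - Y x (1 - e)) <= n.
Proof.
  intros He Hn Hen HMe.
  assert (He' : strip x (1 - e)) by (unfold strip; lra).
  assert (HY := Y_bounds x (1 - e) He').
  assert (Hf := flux_height Q (psi x (1 - e)) HQ (psi_bounds x (1 - e) He')).
  fold (Y x (1 - e)) in Hf.
  assert (Hp := psi_lipschitz_2 x 1 (1 - e)). rewrite psi_top in Hp.
  replace (1 - (1 - e)) with e in Hp by ring.
  rewrite (Rabs_pos_eq e) in Hp by lra. apply Rabs_le_between in Hp.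
  assert (HYn : 1 - Y x (1 - e) <= n).
  { apply Rnot_lt_le. intros Hlt. unfold flux in Hf. set (w := Y x (1 - e)) in *.
    assert (Hw : Q * ((1 - w) * (1 - w)) <= Q - Q * (3 * w ^ 2 - 2 * w ^ 3)).
    { apply Rminus_le_0.
      replace (_ - _) with (2 * Q * w * ((1 - w) * (1 - w))) by ring.
      apply Rmult_le_pos; nra. }
    assert (Q * (n * n) < Q * ((1 - w) * (1 - w))) by (apply Rmult_lt_compat_l; nra). lra. }
  apply Rabs_le. lra.
Qed.

(* The Bernoulli law makes this equal to [p + v2^2] up to a function of [x]. *)
Definition q (x y : R) : R :=
  (poiseuille Q (Y x y) * poiseuille Q (Y x y) + v2 x y * v2 x y - v1 x y * v1 x y) / 2.

(** On a cross section [bernoulli_section] gives [q = p + v2^2 - c] with a constant [c], and the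
    vertical momentum equation supplies the derivative of the right side. *)
Lemma q_derive_2 (x y : R) : strip x y ->
  is_derive (q x) y (- (a1 x y * v2 x y + v1 x y * b1 x y)).
Proof.
  intros Hy. set (c := bernoulli x y - poiseuille Q (Y x y) ^ 2 / 2).
  apply is_derive_ext_loc with (fun t => p x t + v2 x t * v2 x t - c).
  - assert (Hm : 0 < Rmin y (1 - y)) by (apply Rmin_glb_lt; unfold strip in Hy; lra).
    exists (mkposreal _ Hm). intros t Ht. apply Rabs_def2 in Ht. simpl in Ht.
    unfold minus, plus, opp in Ht; simpl in Ht.
    assert (H2 := Rmin_l y (1 - y)). assert (H3 := Rmin_r y (1 - y)).
    assert (Hc := bernoulli_section x y t Hy ltac:(unfold strip; lra)).
    fold (Y x y) (Y x t) c in Hc. rewrite Hc. unfold bernoulli, q.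
    match goal with |- ?l = ?r => change (l = r :> R) end. field.
  - replace (- (a1 x y * v2 x y + v1 x y * b1 x y)) with
      (- (v1 x y * b1 x y - v2 x y * a1 x y) + (- a1 x y * v2 x y + v2 x y * - a1 x y) - 0)
      by ring.
    apply (is_derive_minus (fun t => p x t + v2 x t * v2 x t)); [|apply is_derive_const_R].
    apply (is_derive_plus (p x)); [now apply Hpy|].
    apply (is_derive_Rmult (v2 x) (v2 x)); auto.
Qed.

Lemma q_continuity_2d (x y : R) : strip x y -> continuity_2d_pt q x y.
Proof.
  intros Hy. unfold q, Rdiv.
  apply continuity_2d_pt_mult; [|apply continuity_2d_pt_const].
  apply continuity_2d_pt_minus; [apply continuity_2d_pt_plus|];
    apply continuity_2d_pt_mult;
    auto using v1_continuity_2d, v2_continuity_2d, poiseuille_Y_continuity_2d.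
Qed.

(** A bound for [|q|]: the Poiseuille term is at most [(6 Q)^2 / 2], and [M^2] covers the velocity
    terms. *)
Definition K : R := 18 * Q * Q + M * M.

Lemma q_bound (x y : R) : strip x y -> Rabs (q x y) <= K.
Proof.
  intros Hy. assert (HU := poiseuille_Y_pos x y Hy). assert (HY := Y_bounds x y Hy).
  assert (HU' : poiseuille Q (Y x y) <= 6 * Q).
  { unfold poiseuille. set (w := Y x y) in *. assert (w * (1 - w) <= 1) by nra. nra. }
  assert (H1 := proj1 (Rabs_le_between _ _) (Hv1 x y)).
  assert (H2 := proj1 (Rabs_le_between _ _) (Hv2 x y)).
  apply Rabs_le. unfold q, K. set (U := poiseuille Q (Y x y)) in *.
  assert (0 <= U * U <= 36 * Q * Q) by (split; nra).
  assert (0 <= v1 x y * v1 x y <= M * M) by (split; nra).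
  assert (0 <= v2 x y * v2 x y <= M * M) by (split; nra).
  lra.
Qed.

(** * The functional [J] and its differential inequality *)

Definition J (e x : R) : R := RInt (fun y => v1 x y * v2 x y * (y - Y x y)) e (1 - e).

Definition dJ (x y : R) : R :=
  (a1 x y * v2 x y + v1 x y * b1 x y) * (y - Y x y) +
  v1 x y * v2 x y * (v2 x y / poiseuille Q (Y x y)).

Definition energy (e x : R) : R := RInt (fun y => v2 x y * v2 x y / 2) e (1 - e).

Lemma y_minus_Y_continuity_2d (x y : R) : strip x y ->
  continuity_2d_pt (fun s t => t - Y s t) x y.
Proof.
  intros Hy. apply continuity_2d_pt_minus; [apply continuity_2d_pt_id2|].
  now apply Y_continuity_2d.
Qed.

Lemma J_integrand_continuity_2d (x y : R) : strip x y ->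
  continuity_2d_pt (fun s t => v1 s t * v2 s t * (t - Y s t)) x y.
Proof.
  intros Hy. repeat apply continuity_2d_pt_mult;
    auto using v1_continuity_2d, v2_continuity_2d, y_minus_Y_continuity_2d.
Qed.

Lemma v2_sqr_continuity_2d (x y : R) : continuity_2d_pt (fun s t => v2 s t * v2 s t / 2) x y.
Proof.
  apply continuity_2d_pt_mult; [|apply continuity_2d_pt_const].
  apply continuity_2d_pt_mult; apply v2_continuity_2d.
Qed.

Lemma div_poiseuille_Y_continuity_2d (f : R -> R -> R) (x y : R) : strip x y ->
  continuity_2d_pt f x y -> continuity_2d_pt (fun s t => f s t / poiseuille Q (Y s t)) x y.
Proof.
  intros Hy Hf. apply continuity_2d_pt_mult; [exact Hf|].
  apply continuity_2d_pt_inv; [now apply poiseuille_Y_continuity_2d|].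
  now apply Rgt_not_eq, poiseuille_Y_pos.
Qed.

Lemma u1u2_derive_1_continuity_2d (x y : R) : strip x y ->
  continuity_2d_pt (fun s t => a1 s t * v2 s t + v1 s t * b1 s t) x y.
Proof.
  intros Hy. apply continuity_2d_pt_plus; apply continuity_2d_pt_mult;
    auto using v1_continuity_2d, v2_continuity_2d.
Qed.

Lemma dJ_continuity_2d (x y : R) : strip x y -> continuity_2d_pt dJ x y.
Proof.
  intros Hy. unfold dJ.
  apply continuity_2d_pt_plus; apply continuity_2d_pt_mult;
    auto using u1u2_derive_1_continuity_2d, y_minus_Y_continuity_2d,
      div_poiseuille_Y_continuity_2d, v2_continuity_2d.
  apply continuity_2d_pt_mult; auto using v1_continuity_2d, v2_continuity_2d.
Qed.

Lemma ex_RInt_strip (f : R -> R -> R) (e x : R) : 0 < e < 1 / 2 ->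
  (forall y, strip x y -> continuity_2d_pt f x y) -> ex_RInt (f x) e (1 - e).
Proof.
  intros He Hf. apply (ex_RInt_continuous (V := R_CompleteNormedModule)).
  intros t. rewrite Rmin_left, Rmax_right by lra. intros Ht.
  apply continuity_2d_pt_section, Hf. unfold strip. lra.
Qed.

Lemma J_derive (e x : R) : 0 < e < 1 / 2 ->
  is_derive (J e) x (RInt (dJ x) e (1 - e)).
Proof.
  intros He.
  apply (is_derive_RInt_strip (fun s t => v1 s t * v2 s t * (t - Y s t))); try lra.
  - intros s t Ht. unfold dJ.
    replace (v1 s t * v2 s t * (v2 s t / poiseuille Q (Y s t))) with
      (v1 s t * v2 s t * (0 - - v2 s t / poiseuille Q (Y s t)))
      by (unfold Rdiv; ring).
    apply (is_derive_Rmult (fun u => v1 u t * v2 u t) (fun u => t - Y u t)).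
    + apply (is_derive_Rmult (fun u => v1 u t) (fun u => v2 u t)); auto.
    + apply (is_derive_minus (fun _ => t)); [apply is_derive_const_R|].
      now apply Y_derive_1.
  - exact dJ_continuity_2d.
  - exact J_integrand_continuity_2d.
Qed.

(* [dJ] minus the [y]-derivative of [- q * (y - Y)] is
   [v2^2 / 2 * (1 + v1 / U) + (U - v1)^2 * (U + v1) / (2 * U)], [U := poiseuille Q (Y x y)]. *)
Lemma J_derive_ge (e n x : R) : 0 < e < 1 / 2 -> 0 < n -> e <= n -> M * e <= Q * (n * n) ->
  energy e x - 2 * K * n <= RInt (dJ x) e (1 - e).
Proof.
  intros He Hn Hen HMe.
  set (w := fun y => - (q x y * (y - Y x y))).
  set (dw := fun x y => - (- (a1 x y * v2 x y + v1 x y * b1 x y) * (y - Y x y)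
    + q x y * (1 - v1 x y / poiseuille Q (Y x y)))).
  assert (Hcdw : forall y, strip x y -> continuity_2d_pt dw x y).
  { intros y Hy. apply continuity_2d_pt_opp, continuity_2d_pt_plus.
    - apply continuity_2d_pt_mult; [|now apply y_minus_Y_continuity_2d].
      now apply continuity_2d_pt_opp, u1u2_derive_1_continuity_2d.
    - apply continuity_2d_pt_mult; [now apply q_continuity_2d|].
      apply continuity_2d_pt_minus; [apply continuity_2d_pt_const|].
      apply div_poiseuille_Y_continuity_2d; auto using v1_continuity_2d. }
  assert (Hdw : is_RInt (dw x) e (1 - e) (w (1 - e) - w e)).
  { apply (is_RInt_derive w).
    - intros y. rewrite Rmin_left, Rmax_right by lra. intros Hy.
      assert (Hy' : strip x y) by (unfold strip; lra).
      apply (is_derive_opp (fun y => q x y * (y - Y x y))).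
      apply (is_derive_Rmult (q x) (fun y => y - Y x y)); [now apply q_derive_2|].
      apply (is_derive_minus (fun y => y) (Y x)); [|now apply Y_derive_2].
      exact (is_derive_id (K := R_AbsRing) y).
    - intros y. rewrite Rmin_left, Rmax_right by lra. intros Hy.
      apply continuity_2d_pt_section, Hcdw. unfold strip; lra. }
  assert (Hen' : is_RInt (fun y => v2 x y * v2 x y / 2) e (1 - e) (energy e x)).
  { apply (RInt_correct (V := R_CompleteNormedModule)).
    apply (ex_RInt_strip (fun x y => v2 x y * v2 x y / 2)); auto using v2_sqr_continuity_2d. }
  assert (Hsum := is_RInt_plus (V := R_NormedModule) _ _ _ _ _ _ Hen' Hdw).
  assert (Hle : RInt (fun y => v2 x y * v2 x y / 2 + dw x y) e (1 - e)
    <= RInt (dJ x) e (1 - e)).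
  { apply RInt_le; [lra | eexists; exact Hsum | | ].
    - apply ex_RInt_strip; auto using dJ_continuity_2d.
    - intros y Hy. assert (Hy' : strip x y) by (unfold strip; lra).
      assert (HU := poiseuille_Y_pos x y Hy'). assert (Hp := Hpos x y Hy').
      apply Rminus_le_0. unfold dw, dJ, q. set (U := poiseuille Q (Y x y)) in *.
      (* Of the identity above, the part [v2^2 / 2] is kept as [energy]; the rest is nonnegative
         because [v1] and [U] are positive. *)
      replace (_ - _) with (v1 x y * (v2 x y * v2 x y) / (2 * U) +
        (U - v1 x y) * (U - v1 x y) * (U + v1 x y) / (2 * U)) by (field; lra).
      apply Rplus_le_le_0_compat; (apply Rdiv_le_0_compat; [|lra]).
      + apply Rmult_le_pos; [lra | apply Rle_0_sqr].
      + apply Rmult_le_pos; [apply Rle_0_sqr | lra]. }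
  assert (Hval : RInt (fun y => v2 x y * v2 x y / 2 + dw x y) e (1 - e)
    = energy e x + (w (1 - e) - w e)) by exact (is_RInt_unique _ _ _ _ Hsum).
  rewrite Hval in Hle.
  assert (HK : 0 <= K) by (unfold K; nra).
  (* Each end of the truncated section costs at most [K n], which explains the error [2 K n]. *)
  assert (Hw : forall y, strip x y -> Rabs (y - Y x y) <= n -> Rabs (w y) <= K * n).
  { intros y Hy Hyn. unfold w. rewrite Rabs_Ropp, Rabs_mult.
    apply Rmult_le_compat; auto using Rabs_pos, q_bound. }
  assert (H1 := Hw e ltac:(unfold strip; lra) (Y_near_bottom x e n ltac:(lra) Hn Hen HMe)).
  assert (H2 := Hw (1 - e) ltac:(unfold strip; lra) (Y_near_top x e n ltac:(lra) Hn Hen HMe)).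
  apply Rabs_le_between in H1. apply Rabs_le_between in H2. lra.
Qed.

Lemma J_integrand_bound (x y : R) : strip x y ->
  Rabs (v1 x y * v2 x y * (y - Y x y)) <= M * Rabs (v2 x y).
Proof.
  intros Hy. assert (HY := Y_bounds x y Hy). unfold strip in Hy.
  rewrite !Rabs_mult.
  assert (H1 : Rabs (y - Y x y) <= 1) by (apply Rabs_le; lra).
  assert (H2 := Rabs_pos (y - Y x y)). assert (H3 := Rabs_pos (v2 x y)).
  assert (H4 := Rabs_pos (v1 x y)). assert (H5 := Hv1 x y).
  assert (Rabs (v1 x y) * Rabs (v2 x y) <= M * Rabs (v2 x y)) by nra.
  assert (0 <= Rabs (v1 x y) * Rabs (v2 x y)) by nra.
  nra.
Qed.

Lemma J_bound (e x : R) : 0 < e < 1 / 2 -> Rabs (J e x) <= M * M.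
Proof.
  intros He. eapply Rle_trans; [apply abs_RInt_le_const with (M := M * M)|].
  - lra.
  - apply (ex_RInt_strip (fun x y => v1 x y * v2 x y * (y - Y x y)));
      auto using J_integrand_continuity_2d.
  - intros y Hy. eapply Rle_trans; [apply J_integrand_bound; unfold strip; lra|].
    apply Rmult_le_compat_l; [lra | apply Hv2].
  - nra.
Qed.

(** Young's inequality [M |v2| <= l + M^2 v2^2 / (4 l)], integrated, gives
    [|J| <= l + M^2 / (2 l) energy]. The term [l] absorbs half of the assumed lower bound for
    [|J|]. *)
Lemma J_le_energy (e l x : R) : 0 < e < 1 / 2 -> 0 < l -> 2 * l <= Rabs (J e x) ->
  2 * l * l / (M * M) <= energy e x.
Proof.
  intros He Hl HJ.
  assert (Hi : ex_RInt (fun y => v1 x y * v2 x y * (y - Y x y)) e (1 - e)).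
  { apply (ex_RInt_strip (fun x y => v1 x y * v2 x y * (y - Y x y)));
      auto using J_integrand_continuity_2d. }
  assert (Hen : is_RInt (fun y => v2 x y * v2 x y / 2) e (1 - e) (energy e x)).
  { apply (RInt_correct (V := R_CompleteNormedModule)).
    apply (ex_RInt_strip (fun x y => v2 x y * v2 x y / 2)); auto using v2_sqr_continuity_2d. }
  assert (Hs := is_RInt_plus (V := R_NormedModule) _ _ _ _ _ _
    (is_RInt_const (V := R_NormedModule) e (1 - e) l)
    (is_RInt_scal (V := R_NormedModule) _ _ _ (M * M / (2 * l)) _ Hen)).
  assert (Hle : Rabs (J e x) <= (1 - e - e) * l + M * M / (2 * l) * energy e x).
  { eapply Rle_trans; [apply abs_RInt_le; [lra | exact Hi]|].
    replace ((1 - e - e) * l + M * M / (2 * l) * energy e x) with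
      (RInt (fun y => l + M * M / (2 * l) * (v2 x y * v2 x y / 2)) e (1 - e))
      by exact (is_RInt_unique _ _ _ _ Hs).
    apply RInt_le; [lra | | eexists; exact Hs |].
    - apply ex_RInt_norm, Hi.
    - intros y Hy. eapply Rle_trans; [apply J_integrand_bound; unfold strip; lra|].
      assert (Hsq : v2 x y * v2 x y = Rabs (v2 x y) * Rabs (v2 x y))
        by (rewrite <- Rabs_mult, Rabs_pos_eq; nra).
      rewrite Hsq. set (a := Rabs (v2 x y)).
      apply Rminus_le_0.
      replace (_ - _) with ((2 * l - M * a) * (2 * l - M * a) / (4 * l)) by (field; lra).
      apply Rdiv_le_0_compat; [apply Rle_0_sqr | lra]. }
  assert (H1 : l <= M * M / (2 * l) * energy e x) by nra.
  apply Rmult_le_reg_r with (M * M / (2 * l)).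
  - apply Rdiv_lt_0_compat; nra.
  - replace (2 * l * l / (M * M) * (M * M / (2 * l))) with l by (field; lra). lra.
Qed.

(** * Vanishing of the vertical velocity and identification of the flow *)

(** If [v2] is nonzero at a point, the energy near it makes [J] grow by at least [4 l] from [x0] to
    [x0 + r]. Boundedness confines [J] strictly above [- 2 l] at [x0] and below [2 l] at [x0 + r], a
    contradiction. *)
Lemma v2_zero (x0 y0 : R) : strip x0 y0 -> v2 x0 y0 = 0.
Proof.
  intros Hy0. apply NNPP. intros Hne. unfold strip in Hy0.
  assert (HK : 0 < K) by (unfold K; nra).
  set (D := Rabs (v2 x0 y0) / 2).
  assert (HD : 0 < D) by (apply Rabs_pos_lt in Hne; unfold D; lra).
  set (m := Rmin y0 (1 - y0)).
  assert (Hm : 0 < m) by (apply Rmin_glb_lt; lra).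
  assert (Hm1 : m <= y0) by apply Rmin_l. assert (Hm2 : m <= 1 - y0) by apply Rmin_r.
  (* On the square of side [2 r] around the point, [v2] varies by at most [2 L r <= D], so [|v2|]
     stays at least [D]. *)
  set (r := Rmin (D / (2 * L)) (m / 2)).
  assert (Hr : 0 < r) by (apply Rmin_glb_lt; [apply Rdiv_lt_0_compat|]; lra).
  assert (Hr1 : L * r <= D / 2).
  { apply Rle_trans with (L * (D / (2 * L))); [|right; field; lra].
    apply Rmult_le_compat_l; [lra | apply Rmin_l]. }
  assert (Hr2 : r <= m / 2) by apply Rmin_r.
  (* [4 l] is the increase of [J] at rate [r D^2 / 2] over length [r]. *)
  set (l := r * r * (D * D) / 8).
  assert (HDD : 0 < D * D) by exact (Rmult_lt_0_compat _ _ HD HD).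
  assert (Hl : 0 < l) by (unfold l; apply Rdiv_lt_0_compat; [|lra];
    exact (Rmult_lt_0_compat _ _ (Rmult_lt_0_compat _ _ Hr Hr) HDD)).
  set (k := l * l / (M * M)).
  assert (Hk : 0 < k) by (apply Rdiv_lt_0_compat; apply Rmult_lt_0_compat; assumption).
  (* The truncation error [2 K n] uses up at most half of the local energy [r D^2] and at most half
     of the bound [2 k] from [J_le_energy]. *)
  set (n := Rmin (r * (D * D) / 2) k / (2 * K)).
  assert (Hn : 0 < n).
  { apply Rdiv_lt_0_compat; [|lra]. apply Rmin_glb_lt; [|lra].
    apply Rdiv_lt_0_compat; [|lra]. now apply Rmult_lt_0_compat. }
  assert (HnK : 2 * K * n = Rmin (r * (D * D) / 2) k) by (unfold n; field; lra).
  assert (Hn1 : 2 * K * n <= r * (D * D) / 2) by (rewrite HnK; apply Rmin_l).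
  assert (Hn2 : 2 * K * n <= k) by (rewrite HnK; apply Rmin_r).
  (* The bound [m / 2] keeps [[y0 - r, y0 + r]] inside [[e, 1 - e]]; the last two bounds are the
     requirements of [J_derive_ge]. *)
  set (e := Rmin (Rmin (1 / 4) (m / 2)) (Rmin n (Q * (n * n) / M))).
  assert (He0 : 0 < e).
  { repeat apply Rmin_glb_lt; try lra. apply Rdiv_lt_0_compat; [|lra].
    exact (Rmult_lt_0_compat _ _ HQ (Rmult_lt_0_compat _ _ Hn Hn)). }
  assert (He1 : e <= 1 / 4) by (eapply Rle_trans; [apply Rmin_l | apply Rmin_l]).
  assert (He2 : e <= m / 2) by (eapply Rle_trans; [apply Rmin_l | apply Rmin_r]).
  assert (He3 : e <= n) by (eapply Rle_trans; [apply Rmin_r | apply Rmin_l]).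
  assert (He4 : M * e <= Q * (n * n)).
  { apply Rle_trans with (M * (Q * (n * n) / M)); [|right; field; lra].
    apply Rmult_le_compat_l; [lra|].
    eapply Rle_trans; [apply Rmin_r | apply Rmin_r]. }
  assert (He : 0 < e < 1 / 2) by lra.
  set (J' := fun x : R => (RInt (dJ x) e (1 - e)) : R).
  assert (HJ : forall x, is_derive (J e) x (J' x)) by (intros x; now apply J_derive).
  assert (HJ' : forall x, energy e x - 2 * K * n <= J' x) by (intros x; now apply J_derive_ge).
  assert (HJB : forall x, - (M * M) <= J e x <= M * M)
    by (intros x; apply Rabs_le_between, J_bound, He).
  assert (Hgrow : forall x, 2 * l <= Rabs (J e x) -> k <= J' x).
  { intros x Hx. assert (H := J_le_energy e l x He Hl Hx). specialize (HJ' x).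
    replace (2 * l * l / (M * M)) with (2 * k) in H by (unfold k; field; lra). lra. }
  assert (Hhi : J e (x0 + r) < 2 * l).
  { apply (bounded_growth (J e) J' (M * M) (2 * l) k HJ); [apply HJB | exact Hk |].
    intros x Hx. apply Hgrow. eapply Rle_trans; [exact Hx | apply Rle_abs]. }
  assert (Hlo : - J e x0 < 2 * l).
  { rewrite <- (Ropp_involutive x0).
    apply (bounded_growth (fun x => - J e (- x)) (fun x => J' (- x)) (M * M) (2 * l) k).
    - intros x.
      replace (J' (- x)) with (- (-1 * J' (- x))) by ring.
      apply (is_derive_opp (fun x => J e (- x))).
      apply (is_derive_comp (J e) (fun x => - x)); [apply HJ|].
      auto_derive; [trivial | ring].
    - intros x. specialize (HJB (- x)). lra.
    - exact Hk.
    - intros x Hx. apply Hgrow. rewrite <- Rabs_Ropp.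
      eapply Rle_trans; [exact Hx | apply Rle_abs]. }
  assert (Hen : forall x, x0 <= x <= x0 + r -> r * (D * D) <= energy e x).
  { intros x Hx.
    assert (Hex : forall a b, ex_RInt (fun y => v2 x y * v2 x y / 2) a b).
    { intros a b. apply (ex_RInt_continuous (V := R_CompleteNormedModule)). intros z _.
      apply (continuity_2d_pt_section (fun s t => v2 s t * v2 s t / 2)), v2_sqr_continuity_2d. }
    assert (Hsplit : energy e x = RInt (fun y => v2 x y * v2 x y / 2) e (y0 - r) +
      (RInt (fun y => v2 x y * v2 x y / 2) (y0 - r) (y0 + r) +
       RInt (fun y => v2 x y * v2 x y / 2) (y0 + r) (1 - e))).
    { symmetry. unfold energy.
      transitivity (RInt (fun y => v2 x y * v2 x y / 2) e (y0 - r) +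
        RInt (fun y => v2 x y * v2 x y / 2) (y0 - r) (1 - e)).
      - f_equal. exact (RInt_Chasles _ _ _ _ (Hex _ _) (Hex _ _)).
      - exact (RInt_Chasles _ _ _ _ (Hex _ _) (Hex _ _)). }
    assert (H1 : 0 <= RInt (fun y => v2 x y * v2 x y / 2) e (y0 - r))
      by (apply RInt_ge_0; [lra | apply Hex | intros; nra]).
    assert (H3 : 0 <= RInt (fun y => v2 x y * v2 x y / 2) (y0 + r) (1 - e))
      by (apply RInt_ge_0; [lra | apply Hex | intros; nra]).
    assert (Hc : is_RInt (fun _ => D * D / 2) (y0 - r) (y0 + r) ((y0 + r - (y0 - r)) * (D * D / 2)))
      by apply (is_RInt_const (V := R_NormedModule)).
    assert (H2 : r * (D * D) <= RInt (fun y => v2 x y * v2 x y / 2) (y0 - r) (y0 + r)).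
    { replace (r * (D * D)) with ((y0 + r - (y0 - r)) * (D * D / 2)) by field.
      assert (Hcu : RInt (fun _ => D * D / 2) (y0 - r) (y0 + r) =
        (y0 + r - (y0 - r)) * (D * D / 2)) by exact (is_RInt_unique _ _ _ _ Hc).
      rewrite <- Hcu.
      apply RInt_le; [lra | eexists; exact Hc | apply Hex |].
      intros y Hy. assert (Hd := Hl2 x0 y0 x y).
      assert (Hxy : Rabs (x0 - x) + Rabs (y0 - y) <= 2 * r).
      { unfold Rabs. repeat destruct Rcase_abs; lra. }
      assert (HDv : D <= Rabs (v2 x y)).
      { assert (L * (Rabs (x0 - x) + Rabs (y0 - y)) <= L * (2 * r))
          by (apply Rmult_le_compat_l; lra).
        assert (Ht := Rabs_triang_inv (v2 x0 y0) (v2 x y)). unfold D in *. lra. }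
      assert (Hsq : v2 x y * v2 x y = Rabs (v2 x y) * Rabs (v2 x y))
        by (rewrite <- Rabs_mult, Rabs_pos_eq; [reflexivity | apply Rle_0_sqr]).
      rewrite Hsq. nra. }
    lra. }
  destruct (MVT_gen (J e) x0 (x0 + r) J') as [c [Hc Heq]].
  - intros x _. apply HJ.
  - intros x _. apply (is_derive_continuity_pt _ _ _ (HJ x)).
  - rewrite Rmin_left, Rmax_right in Hc by lra.
    specialize (HJ' c). specialize (Hen c Hc).
    replace (x0 + r - x0) with r in Heq by ring.
    assert (H : r * (D * D) / 2 * r <= J' c * r) by (apply Rmult_le_compat_r; lra).
    assert (4 * l = r * (D * D) / 2 * r) by (unfold l; field). lra.
Qed.

(** Once [v2 = 0], incompressibility gives [a1 = 0]; [v1] is then constant in [x] and equals its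
    upstream limit. *)
Lemma v1_poiseuille (x y : R) : strip x y -> v1 x y = poiseuille Q y.
Proof.
  intros Hy.
  assert (Ha : forall t, a1 t y = 0).
  { intros t.
    assert (H : is_derive (v2 t) y 0).
    { apply is_derive_ext_loc with (fun _ => 0); [|apply is_derive_const_R].
      destruct (locally_2d_strip t y Hy) as [d Hd]. exists d. intros z Hz.
      symmetry. apply v2_zero, Hd; [|exact Hz].
      replace (t - t) with 0 by ring. rewrite Rabs_R0. apply cond_pos. }
    assert (H1 := is_derive_unique _ _ _ (Hd22 t y Hy)).
    rewrite (is_derive_unique _ _ _ H) in H1. lra. }
  apply Rminus_diag_uniq, Rabs_eq_0, Rle_antisym; [|apply Rabs_pos].
  apply Rle_0_of_small with 1. intros e He.
  destruct (Hup e (proj1 He)) as [X HX].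
  destruct (MVT_gen (fun t => v1 t y) (X - 1) x (fun t => a1 t y)) as [c [_ Hc]].
  - intros t _. now apply Hd11.
  - intros t _. eapply is_derive_continuity_pt. now apply Hd11.
  - rewrite Ha in Hc. replace (v1 x y) with (v1 (X - 1) y) by lra.
    rewrite Rmult_1_l. unfold strip in Hy. apply HX; lra.
Qed.

End Flow.

(** * Extension of the velocity to the plane and proof of the theorem *)

(* Precomposing with [clamp] makes the velocity Lipschitz on the whole plane, so
   that integrals up to the walls need no one-sided limits. *)
Definition clamp (y : R) : R := Rmax 0 (Rmin 1 y).

Lemma clamp_bounds (y : R) : 0 <= clamp y <= 1.
Proof. unfold clamp, Rmax, Rmin. repeat destruct Rle_dec; lra. Qed.

Lemma clamp_id (y : R) : 0 <= y <= 1 -> clamp y = y.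
Proof. unfold clamp, Rmax, Rmin. repeat destruct Rle_dec; lra. Qed.

Lemma clamp_lipschitz (y z : R) : Rabs (clamp y - clamp z) <= Rabs (y - z).
Proof. unfold clamp, Rmax, Rmin, Rabs. repeat destruct Rle_dec; repeat destruct Rcase_abs; lra. Qed.

Lemma dist_euc_le (x y x' y' : R) : dist_euc x y x' y' <= Rabs (x - x') + Rabs (y - y').
Proof.
  unfold dist_euc. assert (H1 := Rabs_pos (x - x')). assert (H2 := Rabs_pos (y - y')).
  rewrite <- (sqrt_Rsqr (Rabs (x - x') + Rabs (y - y'))) by lra.
  apply sqrt_le_1_alt. rewrite (Rsqr_abs (x - x')), (Rsqr_abs (y - y')).
  unfold Rsqr. nra.
Qed.

Lemma C01_clamp (f : R -> R -> R) : C01_on closed_strip f ->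
  exists M L, 0 < M /\ 0 < L /\ (forall x y, Rabs (f x (clamp y)) <= M) /\
    forall x y x' y', Rabs (f x (clamp y) - f x' (clamp y')) <= L * (Rabs (x - x') + Rabs (y - y')).
Proof.
  (* Adding [1] makes both constants strictly positive, as later divisions require. *)
  intros [[M HM] [L HL]]. exists (Rabs M + 1), (Rabs L + 1).
  assert (H1 := Rabs_pos M). assert (H2 := Rabs_pos L).
  repeat split; try lra.
  - intros x y. specialize (HM x (clamp y) (clamp_bounds y)). assert (H := Rle_abs M). lra.
  - intros x y x' y'.
    eapply Rle_trans; [apply HL; apply clamp_bounds|].
    assert (Hd := dist_euc_le x (clamp y) x' (clamp y')).
    assert (Hc := clamp_lipschitz y y'). assert (H := Rle_abs L).
    assert (Hd0 : 0 <= dist_euc x (clamp y) x' (clamp y')) by apply sqrt_pos.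
    apply Rle_trans with ((Rabs L + 1) * dist_euc x (clamp y) x' (clamp y')).
    + apply Rmult_le_compat_r; lra.
    + apply Rmult_le_compat_l; lra.
Qed.

Lemma clamp_derive_1 (f : R -> R -> R) (x y l : R) : strip x y ->
  is_derive (fun t => f t y) x l -> is_derive (fun t => f t (clamp y)) x l.
Proof. intros Hy. unfold strip in Hy. now rewrite clamp_id by lra. Qed.

Lemma clamp_derive_2 (f : R -> R -> R) (x y l : R) : strip x y ->
  is_derive (fun t => f x t) y l -> is_derive (fun t => f x (clamp t)) y l.
Proof.
  intros Hy. apply is_derive_ext_loc.
  destruct (locally_2d_strip x y Hy) as [d Hd]. exists d. intros z Hz.
  assert (Hz' : strip x z).
  { apply Hd; [|exact Hz]. replace (x - x) with 0 by ring. rewrite Rabs_R0. apply cond_pos. }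
  unfold strip in Hz'. now rewrite clamp_id by lra.
Qed.

Theorem proposition1p3 (Q : R) (u1 u2 : R -> R -> R)
  (hQ : 0 < Q)
  (hC2_1 : C_on 2 strip u1) (hC2_2 : C_on 2 strip u2)
  (hC01_1 : C01_on closed_strip u1) (hC01_2 : C01_on closed_strip u2)
  (heuler : steady_euler strip u1 u2)
  (hslip : slip u1 u2)
  (hpos : forall x1 x2, strip x1 x2 -> 0 < u1 x1 x2)
  (hlim : unif_lim_minfty u1 (poiseuille Q)) :
  forall x1 x2, strip x1 x2 ->
    (u1 x1 x2, u2 x1 x2) = (poiseuille Q x2, 0).
Proof.
  destruct (C01_clamp u1 hC01_1) as [M1 [L1 [HM1 [HL1 [Hb1 Hl1]]]]].
  destruct (C01_clamp u2 hC01_2) as [M2 [L2 [HM2 [HL2 [Hb2 Hl2]]]]].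
  destruct heuler as [p Hp].
  set (v1 := fun x y => u1 x (clamp y)). set (v2 := fun x y => u2 x (clamp y)).
  assert (Hc : forall x y, strip x y -> clamp y = y)
    by (intros x y Hy; unfold strip in Hy; apply clamp_id; lra).
  assert (Hv1 : forall x y, Rabs (v1 x y) <= Rmax M1 M2)
    by (intros x y; eapply Rle_trans; [apply Hb1 | apply Rmax_l]).
  assert (Hv2 : forall x y, Rabs (v2 x y) <= Rmax M1 M2)
    by (intros x y; eapply Rle_trans; [apply Hb2 | apply Rmax_r]).
  assert (HM : 0 < Rmax M1 M2) by (eapply Rlt_le_trans; [exact HM1 | apply Rmax_l]).
  assert (HL : 0 < Rmax L1 L2) by (eapply Rlt_le_trans; [exact HL1 | apply Rmax_l]).
  assert (Hlip1 : forall x y x' y',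
    Rabs (v1 x y - v1 x' y') <= Rmax L1 L2 * (Rabs (x - x') + Rabs (y - y'))).
  { intros x y x' y'. eapply Rle_trans; [apply Hl1|].
    apply Rmult_le_compat_r; [|apply Rmax_l].
    apply Rplus_le_le_0_compat; apply Rabs_pos. }
  assert (Hlip2 : forall x y x' y',
    Rabs (v2 x y - v2 x' y') <= Rmax L1 L2 * (Rabs (x - x') + Rabs (y - y'))).
  { intros x y x' y'. eapply Rle_trans; [apply Hl2|].
    apply Rmult_le_compat_r; [|apply Rmax_r].
    apply Rplus_le_le_0_compat; apply Rabs_pos. }
  assert (Hbot : forall x, v2 x 0 = 0).
  { intros x. unfold v2. rewrite clamp_id by lra.
    assert (H := hslip x 0 (or_introl eq_refl)). unfold normal1, normal2 in H. lra. }
  assert (Htop : forall x, v2 x 1 = 0).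
  { intros x. unfold v2. rewrite clamp_id by lra.
    assert (H := hslip x 1 (or_intror eq_refl)). unfold normal1, normal2 in H. lra. }
  assert (Hpos : forall x y, strip x y -> 0 < v1 x y)
    by (intros x y Hy; unfold v1; rewrite (Hc x y Hy); auto).
  assert (Hd11 : forall x y, strip x y -> is_derive (fun t => v1 t y) x (Defs.d1 u1 x y)).
  { intros x y Hy. apply (clamp_derive_1 u1 x y _ Hy), Derive_correct.
    now destruct (hC2_1 x y Hy) as [_ [H _]]. }
  assert (Hd12 : forall x y, strip x y -> is_derive (v1 x) y (Defs.d2 u1 x y)).
  { intros x y Hy. apply (clamp_derive_2 u1 x y _ Hy), Derive_correct.
    now destruct (hC2_1 x y Hy) as [_ [_ [H _]]]. }
  assert (Hd21 : forall x y, strip x y -> is_derive (fun t => v2 t y) x (Defs.d1 u2 x y)).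
  { intros x y Hy. apply (clamp_derive_1 u2 x y _ Hy), Derive_correct.
    now destruct (hC2_2 x y Hy) as [_ [H _]]. }
  (* The divergence equation enters here, replacing [d2 u2] by [- d1 u1]. *)
  assert (Hd22 : forall x y, strip x y -> is_derive (v2 x) y (- Defs.d1 u1 x y)).
  { intros x y Hy. destruct (Hp x y Hy) as [_ [_ [_ [_ Hdiv]]]].
    replace (- Defs.d1 u1 x y) with (Defs.d2 u2 x y) by lra.
    apply (clamp_derive_2 u2 x y _ Hy), Derive_correct.
    now destruct (hC2_2 x y Hy) as [_ [_ [H _]]]. }
  assert (Hca1 : forall x y, strip x y -> continuity_2d_pt (Defs.d1 u1) x y)
    by (intros x y Hy; now destruct (hC2_1 x y Hy) as [_ [_ [_ [[H _] _]]]]).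
  assert (Hca2 : forall x y, strip x y -> continuity_2d_pt (Defs.d2 u1) x y)
    by (intros x y Hy; now destruct (hC2_1 x y Hy) as [_ [_ [_ [_ [H _]]]]]).
  assert (Hcb1 : forall x y, strip x y -> continuity_2d_pt (Defs.d1 u2) x y)
    by (intros x y Hy; now destruct (hC2_2 x y Hy) as [_ [_ [_ [[H _] _]]]]).
  assert (Hpx : forall x y, strip x y ->
    is_derive (fun t => p t y) x (- (v1 x y * Defs.d1 u1 x y + v2 x y * Defs.d2 u1 x y))).
  { intros x y Hy. destruct (Hp x y Hy) as [Hex [_ [He _]]].
    unfold v1, v2. rewrite (Hc x y Hy).
    replace (- _) with (Defs.d1 p x y) by lra. now apply Derive_correct. }
  assert (Hpy : forall x y, strip x y ->
    is_derive (p x) y (- (v1 x y * Defs.d1 u2 x y - v2 x y * Defs.d1 u1 x y))).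
  { intros x y Hy. destruct (Hp x y Hy) as [_ [Hex [_ [He Hdiv]]]].
    unfold v1, v2. rewrite (Hc x y Hy).
    replace (- _) with (Defs.d2 p x y); [now apply (Derive_correct (p x))|].
    replace (Defs.d2 u2 x y) with (- Defs.d1 u1 x y) in He by lra. lra. }
  assert (Hup : forall e, 0 < e -> exists X, forall x, x < X ->
    forall y, 0 <= y <= 1 -> Rabs (v1 x y - poiseuille Q y) <= e).
  { intros e He. destruct (hlim (mkposreal e He)) as [X HX]. exists X.
    intros x Hx y Hy. unfold v1. rewrite clamp_id by exact Hy. left. now apply HX. }
  intros x y Hy.
  assert (E1 : v1 x y = poiseuille Q y) 
    by now apply (v1_poiseuille Q (Rmax M1 M2) (Rmax L1 L2) v1 v2 p
      (Defs.d1 u1) (Defs.d2 u1) (Defs.d1 u2)).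
  assert (E2 : v2 x y = 0) 
    by now apply (v2_zero Q (Rmax M1 M2) (Rmax L1 L2) v1 v2 p
      (Defs.d1 u1) (Defs.d2 u1) (Defs.d1 u2)).
  unfold v1, v2 in E1, E2. rewrite (Hc x y Hy) in E1, E2. now rewrite E1, E2.
Qed.
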